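(* Let $\mathcal{A}=(A_n)$ be a van Hove sequence on $G$. Let $B$ be the space of Besicovitch $2$-almost periodic functions with respect to $\mathcal{A}$, and let $B/\!\equiv$ be its quotient by the relation $f\equiv g\iff\|f-g\|_{\mathsf{B},2,\mathcal{A}}=0$, with $[f]$ the class of $f$. (a) The map $\langle\cdot,\cdot\rangle_{\mathcal{A}}:(B/\!\equiv)\times(B/\!\equiv)\to\mathbb{C}$ defined by $$\langle[f],[g]\rangle_{\mathcal{A}}=\lim_{n\to\infty}\frac{1}{|A_n|}\int_{A_n}f(t)\,\overline{g(t)}\,\mathrm{d}t$$ is an inner product on $B/\!\equiv$, and the norm defined by it is $\|\cdot\|_{\mathsf{B},2,\mathcal{A}}$. (b) The space $(B/\!\equiv,\langle\cdot,\cdot\rangle_{\mathcal{A}})$ is a Hilbert space. (c) The group $\widehat{G}$ (i.e. the classes $[\chi]$, $\chi\in\widehat{G}$) is an orthogonal basis of $B/\!\equiv$. (d) For all $f\in B$ and $\chi\in\widehat{G}$, we have $a_\chi^{\mathcal{A}}(f)=\langle[f],[\chi]\rangle_{\mathcal{A}}$. (e) For all $f\in B$, one has $a_\chi^{\mathcal{A}}(f)\neq0$ for at most countably many characters $\chi$, the Parseval identity $$\|f\|_{\mathsf{B},2,\mathcal{A}}^2=\sum_{\chi\in\widehat{G}}|a_\chi^{\mathcal{A}}(f)|^2$$ holds, and $[f]=\sum_{\chi\in\widehat{G}}a_\chi^{\mathcal{A}}(f)[\chi]$ in $(B/\!\equiv,\|\cdot\|_{\mathsf{B},2,\mathcal{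A}})$.
   Context: $G$ is a locally compact (Hausdorff), $\sigma$-compact abelian group with Haar measure $\theta_G$; $|A|=\theta_G(A)$, and $\mathrm{d}t$ denotes integration against $\theta_G$. $\widehat{G}$ is the dual group. A van Hove sequence $\mathcal{A}=(A_n)$ is a sequence of relatively compact open sets (of positive measure) with $|\partial^K A_n|/|A_n|\to 0$ for every compact $K\subseteq G$, where $\partial^K A=\big(\overline{A+K}\cap\overline{A^c}\big)\cup\big(\overline{A^c-K}\cap\overline{A}\big)$. For $f\in\mathcal{L}^2_{loc}(G)$ put $\|f\|_{\mathsf{B},2,\mathcal{A}}=\limsup_n\big(\frac{1}{|A_n|}\int_{A_n}|f(t)|^2\,\mathrm{d}t\big)^{1/2}$. A function $f\in\mathcal{L}^2_{loc}(G)$ is Besicovitch $2$-almost periodic with respect to $\mathcal{A}$ if for each $\varepsilon>0$ there is a trigonometric polynomial $P$ (finite linear combination of characters) with $\|f-P\|_{\mathsf{B},2,\mathcal{A}}<\varepsilon$. The Fourier--Bohr coefficient is $a_\chi^{\mathcal{A}}(f)=\lim_n\frac{1}{|A_n|}\int_{A_n}\overline{\chi(t)}f(t)\,\mathrm{d}t$ (it exists for Besicovitch almost periodic $f$). *)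

(* Defs.v *)
From HB Require Import structures.
From mathcomp Require Import all_boot all_order all_algebra.
From mathcomp Require Import complex.
From mathcomp Require Import all_classical all_reals all_analysis.
From mathcomp Require Import ring lra.
From mathcomp Require Import measurable_realfun.
From mathcomp Require Import summability.

Set Implicit Arguments.
Unset Strict Implicit.
Unset Printing Implicit Defensive.

Import Order.TTheory GRing.Theory Num.Theory.
Import numFieldNormedType.Exports.

Local Open Scope classical_set_scope.
Local Open Scope ring_scope.
Local Open Scope quotient_scope.

HB.mixin Record isLCAGroup G of TopologicalZmodule G := {
  lca_hausdorff : hausdorff_space G ;
  lca_locally_compact : locally_compact [set: G] ;
  lca_sigma_compact : exists K : nat -> set G,
    (forall n, compact (K n)) /\ \bigcup_n K n = [set: G]
}.

#[short(type="lcaGroupType")]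
HB.structure Definition LCAGroup := {G of isLCAGroup G & TopologicalZmodule G}.

(* g_sigma_algebraType needs a base point. *)
Definition lca_pointed (G : lcaGroupType) : Type := G.
HB.instance Definition _ (G : lcaGroupType) := Choice.on (lca_pointed G).
HB.instance Definition _ (G : lcaGroupType) :=
  isPointed.Build (lca_pointed G) (0 : G).

Definition borel (G : lcaGroupType) :=
  g_sigma_algebraType (@open G : set (set (lca_pointed G))).
HB.instance Definition _ (G : lcaGroupType) := Measurable.on (borel G).

Record haar_measure (R : realType) (G : lcaGroupType) := HaarMeasure {
  haar_val :> {measure set (borel G) -> \bar R} ;
  haar_translation : forall (x : G) (E : set (borel G)), measurable E ->
    haar_val [set x + y | y in (E : set G)] = haar_val E ;
  haar_neq0 : haar_val setT != 0%E ;
  haar_compact : forall K : set G, compact K -> (haar_val K < +oo)%E ;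
  haar_outer : forall E : set (borel G), measurable E ->
    haar_val E =
    ereal_inf [set haar_val U | U in [set U : set G | open U /\ E `<=` U]] ;
  haar_inner : forall U : set G, open U ->
    haar_val U =
    ereal_sup [set haar_val K | K in [set K : set G | compact K /\ K `<=` U]]
}.

Definition vh_boundary (G : lcaGroupType) (K A : set G) : set G :=
  (closure [set a + k | a in A & k in K] `&` closure (~` A)) `|`
  (closure [set a - k | a in ~` A & k in K] `&` closure A).

Record van_hove_sequence (R : realType) (G : lcaGroupType)
    (mu : haar_measure R G) := VanHoveSequence {
  vh_set :> nat -> set G ;
  vh_open : forall n, open (vh_set n) ;
  vh_precompact : forall n, precompact (vh_set n) ;
  vh_gt0 : forall n, (0 < mu (vh_set n))%E ;
  vh_cvg : forall K : set G, compact K ->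
    (mu (vh_boundary K (vh_set n)) * ((fine (mu (vh_set n)))^-1)%:E)%E
      @[n --> \oo] --> 0%E
}.

Definition is_character (R : realType) (G : lcaGroupType) (chi : G -> R[i]) :=
  [/\ continuous (chi : G -> R[i]^o),
      forall x y, chi (x + y) = chi x * chi y &
      forall x, `|chi x| = 1].

Record dual (R : realType) (G : lcaGroupType) := Dual {
  dual_fun :> G -> R[i] ;
  dual_subproof : `[< is_character dual_fun >]
}.
HB.instance Definition _ (R : realType) (G : lcaGroupType) :=
  [isSub for @dual_fun R G].
HB.instance Definition _ (R : realType) (G : lcaGroupType) :=
  [Choice of dual R G by <:].

Definition trig_poly (R : realType) (G : lcaGroupType) (P : G -> R[i]) :=
  exists s : seq (R[i] * dual R G), P = \sum_(c <- s) c.1 *: (c.2 : G -> R[i]).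

Section besicovitch.
Context (R : realType) (G : lcaGroupType) (mu : haar_measure R G).

Definition cabs (z : R[i]) : R := complex.Re `|z|.

Definition L2loc (f : G -> R[i]) :=
  [/\ measurable_fun [set: borel G] (fun t => complex.Re (f t)),
      measurable_fun [set: borel G] (fun t => complex.Im (f t)) &
      forall K : set G, compact K ->
        (\int[mu]_(t in (K : set (borel G))) (cabs (f t) ^+ 2)%:E < +oo)%E].

Context (A : van_hove_sequence mu).

Definition mean (f : G -> R[i]) (n : nat) : R[i]^o :=
  (((fine (mu (A n)))^-1)%:C *
   (Complex (\int[mu]_(t in (A n : set (borel G))) complex.Re (f t))
            (\int[mu]_(t in (A n : set (borel G))) complex.Im (f t))))%R%C.

Definition mean_sqr (f : G -> R[i]) (n : nat) : \bar R :=
  (((fine (mu (A n)))^-1)%:E *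
   \int[mu]_(t in (A n : set (borel G))) (cabs (f t) ^+ 2)%:E)%E.

Definition besi_norm (f : G -> R[i]) : \bar R :=
  limn_esup (fun n => sqrte (mean_sqr f n)).

Definition besicovitch (f : G -> R[i]) :=
  L2loc f /\ forall e : R, 0 < e ->
    exists P : G -> R[i], trig_poly P /\ (besi_norm (f - P)%R < e%:E)%E.

Lemma cabs_sqr z : cabs z ^+ 2 = complex.Re z ^+ 2 + complex.Im z ^+ 2.
Proof.
case: z => a b; rewrite /cabs normc_def /= sqr_sqrtr //.
by rewrite addr_ge0 // sqr_ge0.
Qed.

Lemma cabs_sqr_le (a z w : R[i]) :
  cabs (a * z + w) ^+ 2 <= (cabs a ^+ 2 *+ 2) * cabs z ^+ 2 + cabs w ^+ 2 *+ 2.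
Proof.
rewrite !cabs_sqr; case: a z w => a1 a2 [z1 z2] [w1 w2] /=.
rewrite -subr_ge0.
have -> : (a1 ^+ 2 + a2 ^+ 2) *+ 2 * (z1 ^+ 2 + z2 ^+ 2) +
  (w1 ^+ 2 + w2 ^+ 2) *+ 2 -
  ((a1 * z1 - a2 * z2 + w1) ^+ 2 + (a1 * z2 + a2 * z1 + w2) ^+ 2) =
  (a1 * z1 - a2 * z2 - w1) ^+ 2 + (a1 * z2 + a2 * z1 - w2) ^+ 2 by ring.
by rewrite addr_ge0 ?sqr_ge0.
Qed.

Lemma borel_open (U : set G) : open U -> measurable (U : set (borel G)).
Proof. by move=> oU; apply: sub_sigma_algebra. Qed.

Lemma borel_compact (K : set G) : compact K -> measurable (K : set (borel G)).
Proof.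
move=> cK; rewrite -(setCK (K : set (borel G))); apply: measurableC.
have oK : open (~` K).
  by apply: closed_openC; apply: (compact_closed lca_hausdorff cK).
exact: borel_open.
Qed.

Lemma measurable_cabs_sqr f (D : set (borel G)) : L2loc f ->
  measurable_fun D (EFin \o (fun t => cabs (f t) ^+ 2)).
Proof.
case=> mr mi _; apply/measurable_EFinP.
under eq_fun do rewrite cabs_sqr.
apply: measurable_funD; apply: measurable_funX.
  exact: (measurable_funS measurableT _ mr).
exact: (measurable_funS measurableT _ mi).
Qed.

Lemma measurable_lincomb (a : R[i]) f g : L2loc f -> L2loc g ->
  measurable_fun [set: borel G] (fun t => complex.Re ((a *: f + g) t)) /\
  measurable_fun [set: borel G] (fun t => complex.Im ((a *: f + g) t)).
Proof.
move=> [fr fi _] [gr gi _].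
have addE (z w : R[i]) : z + w =
  Complex (complex.Re z + complex.Re w) (complex.Im z + complex.Im w).
  by case: z w => ? ? [].
have mulE (z w : R[i]) : z * w =
  Complex (complex.Re z * complex.Re w - complex.Im z * complex.Im w)
          (complex.Re z * complex.Im w + complex.Im z * complex.Re w).
  by case: z w => ? ? [].
have E t : (a *: f + g) t = Complex
   (complex.Re a * complex.Re (f t) - complex.Im a * complex.Im (f t)
     + complex.Re (g t))
   (complex.Re a * complex.Im (f t) + complex.Im a * complex.Re (f t)
     + complex.Im (g t)).
  by rewrite -[LHS]/(a * f t + g t) addE mulE.
split; under eq_fun do rewrite E /=.
  by apply: measurable_funD => //; apply: measurable_funB; exact: measurable_funM.
by apply: measurable_funD => //; apply: measurable_funD; exact: measurable_funM.
Qed.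

Lemma integral_cabs_sqr_le (D : set (borel G)) (a : R[i]) f g :
  measurable D -> L2loc f -> L2loc g ->
  (\int[mu]_(t in D) (cabs ((a *: f + g) t) ^+ 2)%:E <=
   (cabs a ^+ 2 *+ 2)%:E * \int[mu]_(t in D) (cabs (f t) ^+ 2)%:E +
   2%:E * \int[mu]_(t in D) (cabs (g t) ^+ 2)%:E)%E.
Proof.
move=> mD lf lg; have [mr mi] := measurable_lincomb a lf lg.
have a0 : 0 <= cabs a ^+ 2 *+ 2 by rewrite mulrn_wge0 ?sqr_ge0.
have mf := measurable_cabs_sqr (D := D) lf.
have mg := measurable_cabs_sqr (D := D) lg.
rewrite -ge0_integralZl_EFin//; last by move=> t _; rewrite lee_fin sqr_ge0.
rewrite -ge0_integralZl_EFin//; last by move=> t _; rewrite lee_fin sqr_ge0.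
rewrite -ge0_integralD//; first last.
- exact: measurable_funeM.
- by move=> t _; rewrite -EFinM lee_fin mulr_ge0 ?sqr_ge0.
- exact: measurable_funeM.
- by move=> t _; rewrite -EFinM lee_fin mulr_ge0 ?sqr_ge0.
apply: ge0_le_integral => //.
- by move=> t _; rewrite lee_fin sqr_ge0.
- apply/measurable_EFinP; under eq_fun do rewrite cabs_sqr.
  apply: measurable_funD; apply: measurable_funX.
    exact: (measurable_funS measurableT _ mr).
  exact: (measurable_funS measurableT _ mi).
- by apply: emeasurable_funD; exact: measurable_funeM.
- move=> t _; rewrite -!EFinM -EFinD lee_fin (mulr_natl (cabs (g t) ^+ 2) 2).
  exact: cabs_sqr_le.
Qed.

Lemma L2loc_lincomb (a : R[i]) f g : L2loc f -> L2loc g -> L2loc (a *: f + g).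
Proof.
move=> lf lg; have [mr mi] := measurable_lincomb a lf lg; split => // K cK.
case: (lf) (lg) => _ _ /(_ K cK) fK [_ _ /(_ K cK) gK].
apply: le_lt_trans (integral_cabs_sqr_le _ (borel_compact cK) lf lg) _.
by rewrite lte_add_pinfty// lte_mul_pinfty// ?lee_fin ?mulrn_wge0 ?sqr_ge0.
Qed.

Lemma continuous_Re : continuous (@complex.Re R : R[i]^o -> R).
Proof.
move=> z P /nbhs_ballP[e/= e0 eP].
apply/nbhs_ballP; exists (e%:C)%C; first by rewrite /= ltcR.
move=> w; rewrite /ball/= => zw; apply: eP; rewrite /ball/=.
rewrite -ltcR (le_lt_trans _ zw)// -raddfB.
exact: normc_ge_Re.
Qed.

Lemma continuous_Im : continuous (@complex.Im R : R[i]^o -> R).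
Proof.
move=> z P /nbhs_ballP[e/= e0 eP].
apply/nbhs_ballP; exists (e%:C)%C; first by rewrite /= ltcR.
move=> w; rewrite /ball/= => zw; apply: eP; rewrite /ball/=.
rewrite -ltcR (le_lt_trans _ zw)// -raddfB.
case: (z - w) => a b; rewrite normc_def /= lecR -sqrtr_sqr ler_wsqrtr//.
by rewrite lerDr sqr_ge0.
Qed.

Lemma continuous_borel (h : G -> R) : continuous h ->
  measurable_fun [set: borel G] (h : borel G -> R).
Proof.
move=> /continuousP ch; apply: (measurability _ (RGenOpens.measurableE R)).
move=> _ [_ [a [b ->] <-]]; rewrite setTI; apply: borel_open.
exact/ch/interval_open.
Qed.

Lemma L2loc_character (chi : dual R G) : L2loc chi.
Proof.
have /asboolP[cchi _ nchi] := dual_subproof chi; split.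
- apply: (@continuous_borel (@complex.Re R \o chi)) => t.
  exact (@continuous_comp G R[i]^o R chi _ t (cchi t) (@continuous_Re _)).
- apply: (@continuous_borel (@complex.Im R \o chi)) => t.
  exact (@continuous_comp G R[i]^o R chi _ t (cchi t) (@continuous_Im _)).
- move=> K cK; under eq_integral do rewrite /cabs nchi expr1n.
  by rewrite integral_cst ?mul1e; [exact: haar_compact|exact: borel_compact].
Qed.

Lemma mean_sqr_ge0 f n : (0 <= mean_sqr f n)%E.
Proof.
rewrite mule_ge0 ?lee_fin ?invr_ge0 ?fine_ge0//.
by apply: integral_ge0 => t _; rewrite lee_fin sqr_ge0.
Qed.

Lemma mean_sqr_lincomb (a : R[i]) f g n : L2loc f -> L2loc g ->
  (mean_sqr (a *: f + g)%R n <=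
   (cabs a ^+ 2 *+ 2)%:E * mean_sqr f n + 2%:E * mean_sqr g n)%E.
Proof.
move=> lf lg; rewrite /mean_sqr muleCA [X in (_ + X)%E]muleCA -ge0_muleDr.
- apply: lee_wpmul2l; first by rewrite lee_fin invr_ge0 fine_ge0.
  exact: (integral_cabs_sqr_le _ (borel_open (vh_open A n))).
- rewrite mule_ge0 ?lee_fin ?mulrn_wge0 ?sqr_ge0//.
  by apply: integral_ge0 => t _; rewrite lee_fin sqr_ge0.
- rewrite mule_ge0 ?lee_fin//.
  by apply: integral_ge0 => t _; rewrite lee_fin sqr_ge0.
Qed.

Lemma besi_norm_ge0 f : (0 <= besi_norm f)%E.
Proof.
apply: limf_esup_ge0 => [|n]; last exact: sqrte_ge0.
by case=> N _ /(_ N (leqnn N)).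
Qed.

Lemma besi_norm_lt f (e : R) : 0 < e -> (besi_norm f < e%:E)%E ->
  \forall n \near \oo, (mean_sqr f n <= (e ^+ 2)%:E)%E.
Proof.
move=> e0 /ereal_inf_lt[_ [V oV <-]] Ve; apply: filterS oV => n Vn.
rewrite leNgt; apply/negP => /ltW en.
have : (sqrte (mean_sqr f n) < e%:E)%E.
  by apply: le_lt_trans Ve; apply: ereal_sup_ubound; exists n.
rewrite ltNge => /negP; apply.
by rewrite -(ger0_norm (ltW e0)) -sqrtr_sqr -[leLHS]/(sqrte (e ^+ 2)%:E)
  lee_sqrt// mean_sqr_ge0.
Qed.

Lemma besi_norm_le f (e : R) : 0 <= e ->
  (\forall n \near \oo, (mean_sqr f n <= (e ^+ 2)%:E)%E) ->
  (besi_norm f <= e%:E)%E.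
Proof.
move=> e0 oV; apply: (@le_trans _ _ (ereal_sup ((fun n => sqrte (mean_sqr f n)) @`
  [set n | (mean_sqr f n <= (e ^+ 2)%:E)%E]))).
  by apply: ereal_inf_lbound; exists [set n | (mean_sqr f n <= (e ^+ 2)%:E)%E].
apply: ge_ereal_sup => _ [n /= ne <-].
by rewrite -(ger0_norm e0) -sqrtr_sqr -[leRHS]/(sqrte (e ^+ 2)%:E)
  lee_sqrt// lee_fin sqr_ge0.
Qed.

Lemma cabs_ge0 (z : R[i]) : 0 <= cabs z.
Proof. by case: z => a b; rewrite /cabs normc_def /= sqrtr_ge0. Qed.

Lemma besi_norm_lincomb (a : R[i]) f g (d : R) : L2loc f -> L2loc g -> 0 < d ->
  (besi_norm f < d%:E)%E -> (besi_norm g < d%:E)%E ->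
  (besi_norm (a *: f + g)%R <= ((cabs a + 1) * 2 * d)%:E)%E.
Proof.
move=> lf lg d0 /(besi_norm_lt d0) fd /(besi_norm_lt d0) gd.
have a0 := cabs_ge0 a.
apply: besi_norm_le; first by rewrite !mulr_ge0 ?addr_ge0// ltW.
apply: filterS2 fd gd => n fd gd.
apply: le_trans (mean_sqr_lincomb _ _ lf lg) _.
apply: (@le_trans _ _ ((cabs a ^+ 2 *+ 2)%:E * (d ^+ 2)%:E +
    2%:E * (d ^+ 2)%:E)%E).
  by apply: leeD; apply: lee_wpmul2l => //; rewrite lee_fin ?mulrn_wge0 ?sqr_ge0.
rewrite -!EFinM -EFinD lee_fin -mulrDl exprMn ler_wpM2r ?sqr_ge0//.
by nra.
Qed.

Lemma trig_poly_lincomb (a : R[i]) (P Q : G -> R[i]) :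
  trig_poly P -> trig_poly Q -> trig_poly (a *: P + Q).
Proof.
move=> [s ->] [r ->]; exists ([seq (a * c.1, c.2) | c <- s] ++ r).
rewrite big_cat big_map scaler_sumr; congr (_ + _).
by apply: eq_bigr => c _; rewrite scalerA.
Qed.

Lemma L2loc0 : L2loc 0.
Proof.
split; [exact: measurable_cst|exact: measurable_cst|move=> K _].
rewrite integral0_eq// => t _.
by rewrite cabs_sqr /= expr0n /= addr0.
Qed.

Lemma L2loc_trig_poly (P : G -> R[i]) : trig_poly P -> L2loc P.
Proof.
move=> [s ->]; apply: big_ind => [|f g lf lg|c _]; first exact: L2loc0.
  by rewrite -[f]scale1r; exact: L2loc_lincomb.
rewrite -[_ *: _]addr0; apply: L2loc_lincomb; last exact: L2loc0.
exact: L2loc_character.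
Qed.

Lemma besi_norm0 : besi_norm (0 : G -> R[i]) = 0%E.
Proof.
apply/eqP; rewrite eq_le besi_norm_ge0 andbT.
apply: besi_norm_le => //; apply: nearW => n.
rewrite /mean_sqr integral0_eq ?mule0// => t _.
by rewrite cabs_sqr /= expr0n /= addr0.
Qed.

Lemma trig_poly_besicovitch (P : G -> R[i]) : trig_poly P -> besicovitch P.
Proof.
move=> tP; split; first exact: L2loc_trig_poly.
by move=> e e0; exists P; rewrite subrr besi_norm0 lte_fin.
Qed.

Definition besi_pred : {pred G -> R[i]} := fun f => `[< besicovitch f >].

Lemma besi_submod_closed : submod_closed besi_pred.
Proof.
have t0 : trig_poly (0 : G -> R[i]) by exists [::]; rewrite big_nil.
split; first exact/asboolP/trig_poly_besicovitch.
move=> a f g /asboolP[lf fP] /asboolP[lg gP]; apply/asboolP; split.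
  exact: L2loc_lincomb.
move=> e e0; have a0 := cabs_ge0 a.
have d0 : 0 < e / ((cabs a + 1) * 4) by rewrite divr_gt0// mulr_gt0// ltr_wpDl.
have [P [tP Pd]] := fP _ d0; have [Q [tQ Qd]] := gP _ d0.
exists (a *: P + Q); split; first exact: trig_poly_lincomb.
have -> : a *: f + g - (a *: P + Q) = a *: (f - P) + (g - Q).
  by rewrite scalerBr opprD addrACA.
have lB (h k : G -> R[i]) : L2loc h -> trig_poly k -> L2loc (h - k).
  move=> lh /L2loc_trig_poly lk.
  by rewrite addrC -scaleN1r; exact: L2loc_lincomb.
apply: le_lt_trans (besi_norm_lincomb _ (lB _ _ lf tP) (lB _ _ lg tQ) d0 Pd Qd) _.
rewrite lte_fin.
have -> : (cabs a + 1) * 2 * (e / ((cabs a + 1) * 4)) = e / 2.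
  by field; rewrite gt_eqF// ltr_wpDl.
by rewrite ltr_pdivrMr// ltr_pMr// ltr1n.
Qed.

HB.instance Definition _ :=
  GRing.isSubmodClosed.Build _ _ besi_pred besi_submod_closed.

Record besi := Besi {
  besi_fun :> G -> R[i] ;
  besi_subproof : besi_fun \in besi_pred
}.
HB.instance Definition _ := [isSub for besi_fun].
HB.instance Definition _ := [Choice of besi by <:].
HB.instance Definition _ := [SubChoice_isSubLmodule of besi by <:].

Lemma character_besi (chi : dual R G) : (chi : G -> R[i]) \in besi_pred.
Proof.
apply/asboolP/trig_poly_besicovitch; exists [:: (1, chi)].
by rewrite big_seq1 scale1r.
Qed.

Definition besi_char (chi : dual R G) : besi := Besi (character_besi chi).

Definition besi_null : {pred besi} := fun f => besi_norm f == 0%E.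

Lemma besi_null_submod_closed : submod_closed besi_null.
Proof.
split; first exact/eqP/besi_norm0.
move=> a f g /eqP f0 /eqP g0; apply/eqP/eqP.
rewrite eq_le besi_norm_ge0 andbT.
have a0 := cabs_ge0 a.
have [/asboolP[lf _] /asboolP[lg _]] := (besi_subproof f, besi_subproof g).
apply/lee_addgt0Pr => e e0; rewrite add0e.
have d0 : 0 < e / ((cabs a + 1) * 2) by rewrite divr_gt0// mulr_gt0// ltr_wpDl.
have -> : e%:E = ((cabs a + 1) * 2 * (e / ((cabs a + 1) * 2)))%:E.
  by congr EFin; field; rewrite gt_eqF// ltr_wpDl.
by apply: besi_norm_lincomb => //; rewrite ?f0 ?g0 lte_fin.
Qed.

HB.instance Definition _ :=
  GRing.isSubmodClosed.Build _ _ besi_null besi_null_submod_closed.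


(* The quotient by the subspace of functions of seminorm zero, that is, by the
   relation besi_norm (f - g) = 0. *)
Definition besi_quot : Type := Quotient.quot besi_null.
HB.instance Definition _ := GRing.Zmodule.on besi_quot.
HB.instance Definition _ : EqQuotient besi (Quotient.equiv besi_null) besi_quot :=
  EqQuotient.on besi_quot.

Definition besi_class (f : besi) : besi_quot := \pi f.

Definition besi_quot_scale (a : R[i]) (x : besi_quot) : besi_quot :=
  besi_class (a *: repr x).

Lemma besi_class_eq (f g : besi) :
  besi_class f = besi_class g <-> besi_norm (f - g) = 0%E.
Proof.
split=> [/eqP|H]; first by rewrite -Quotient.idealrBE => /eqP.
by apply/eqP; rewrite -Quotient.idealrBE; apply/eqP.
Qed.

Lemma besi_classD (f g : besi) : besi_class (f + g) = besi_class f + besi_class g.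
Proof. exact: Quotient.pi_add. Qed.

Lemma besi_classZ (a : R[i]) (f : besi) :
  besi_class (a *: f) = besi_quot_scale a (besi_class f).
Proof.
apply/eqP; rewrite -Quotient.idealrBE -scalerBr rpredZ//.
by rewrite Quotient.idealrBE reprK.
Qed.

Lemma besi_class_repr (x : besi_quot) : besi_class (repr x) = x.
Proof. exact: reprK. Qed.

Lemma besi_quot_scaleA a b x :
  besi_quot_scale a (besi_quot_scale b x) = besi_quot_scale (a * b) x.
Proof. by rewrite -(besi_class_repr x) -!besi_classZ scalerA. Qed.

Lemma besi_quot_scale1 : left_id 1 besi_quot_scale.
Proof. by move=> x; rewrite -(besi_class_repr x) -besi_classZ scale1r. Qed.

Lemma besi_quot_scaleDr : right_distributive besi_quot_scale +%R.
Proof.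
move=> a x y; rewrite -(besi_class_repr x) -(besi_class_repr y) -besi_classD.
by rewrite -!besi_classZ scalerDr besi_classD.
Qed.

Lemma besi_quot_scaleDl x : {morph besi_quot_scale^~ x : a b / a + b}.
Proof.
move=> a b; rewrite -(besi_class_repr x) -!besi_classZ -besi_classD.
by rewrite scalerDl.
Qed.

HB.instance Definition _ := GRing.Zmodule_isLmodule.Build R[i] besi_quot
  besi_quot_scaleA besi_quot_scale1 besi_quot_scaleDr besi_quot_scaleDl.

Definition besi_quot_norm (x : besi_quot) : \bar R := besi_norm (repr x).

Definition besi_ip (x y : besi_quot) : R[i] :=
  lim (mean (fun t => repr x t * (repr y t)^* ) @ \oo).

Definition fourier_bohr (f : G -> R[i]) (chi : dual R G) : R[i] :=
  lim (mean (fun t => (chi t)^* * f t) @ \oo).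

End besicovitch.

Section hilbert.
Context (R : realType) (V : lmodType R[i]).

Definition inner_product (ip : V -> V -> R[i]) :=
  exists form : {dot V for @Num.conj R[i]}, ip = form.

Definition ip_norm (ip : V -> V -> R[i]) (x : V) : R :=
  Num.sqrt (complex.Re (ip x x)).

Definition hilbert_space (ip : V -> V -> R[i]) :=
  inner_product ip /\
  forall u : nat -> V,
    (forall e : R, 0 < e -> exists N, forall m n, (N <= m)%N -> (N <= n)%N ->
      ip_norm ip (u m - u n) < e) ->
    exists l : V, ip_norm ip (u n - l) @[n --> \oo] --> (0 : R).

Definition orthogonal_basis (ip : V -> V -> R[i]) (I : eqType) (b : I -> V) :=
  [/\ forall i, b i != 0,
      forall i j, i != j -> ip (b i) (b j) = 0 &
      forall (x : V) (e : R), 0 < e -> exists s : seq (R[i] * I),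
        ip_norm ip (x - \sum_(c <- s) c.1 *: b c.2) < e].

End hilbert.

(* Main.v *)
Require Import Defs.
From HB Require Import structures.
From mathcomp Require Import all_boot all_order all_algebra.
From mathcomp Require Import complex finmap.
From mathcomp Require Import all_classical all_reals all_analysis.
From mathcomp Require Import summability.
From mathcomp Require Import ring lra measurable_realfun.

Import Order.TTheory GRing.Theory Num.Theory.
Import numFieldNormedType.Exports.

Local Open Scope classical_set_scope.
Local Open Scope ring_scope.

Set Implicit Arguments.
Unset Strict Implicit.
Unset Printing Implicit Defensive.

(* For each n, f, g |-> |A_n|^-1 \int_(A_n) f g^* is a semi-inner product on B.
   Translation invariance of the Haar measure and the van Hove property make
   the means of a nontrivial character tend to 0, so these forms converge on
   trigonometric polynomials, hence, by density and the triangle inequality, on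
   all of B; the limit form induces the Besicovitch seminorm.  Everything but
   completeness is then Hilbert space theory for the orthonormal dense family of
   characters.

   For completeness it is enough to find a limit of trigonometric polynomials
   P_k with ||P_(k+1) - P_k|| < 2^-k.  If |G| = oo, then |A_n| -> oo, and one
   takes the limit P_k on D_k \ (D_0 \cup ... \cup D_(k-1)), where the compact
   sets D_k exhaust G and contain all A_n of small index (Marcinkiewicz).  If
   |G| < oo, then |A_n| -> |G|, and the P_k converge almost everywhere, as in
   the Riesz-Fischer theorem.  Both cases rest on the pointwise inequality
   |P_m - P_l|^2 <= 2^(1-l) \sum_(l <= i < m) 2^i |P_(i+1) - P_i|^2. *)

(** * Complex numbers and semi-inner products *)

Section complex_numbers.
Context {R : realType}.
Implicit Types (z w : R[i]).

Lemma conjCE z : z^* = Complex (complex.Re z) (- complex.Im z).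
Proof. by case: z. Qed.

Lemma mulCE z w : z * w =
  Complex (complex.Re z * complex.Re w - complex.Im z * complex.Im w)
          (complex.Re z * complex.Im w + complex.Im z * complex.Re w).
Proof. by case: z w => ? ? []. Qed.

Lemma addCE z w : z + w =
  Complex (complex.Re z + complex.Re w) (complex.Im z + complex.Im w).
Proof. by case: z w => ? ? []. Qed.

Lemma normC_cabs z : `|z| = (cabs z)%:C%C.
Proof. by rewrite /cabs normc_def. Qed.

Lemma mul_conjC z : z * z^* = (cabs z ^+ 2)%:C%C.
Proof. by rewrite -normCK normC_cabs rmorphXn. Qed.

Lemma cabs_sqr_eq0 z : (cabs z ^+ 2 == 0) = (z == 0).
Proof.
rewrite -(inj_eq (@complexI R)) -mul_conjC -normCK rmorph0.
by rewrite expf_eq0 /= normr_eq0.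
Qed.

Lemma cabsM z w : cabs (z * w) = cabs z * cabs w.
Proof. by apply: (@complexI R); rewrite rmorphM/= -!normC_cabs normrM. Qed.

Lemma cabs_conj z : cabs z^* = cabs z.
Proof. by apply: (@complexI R); rewrite -!normC_cabs norm_conjC. Qed.

Lemma cabsD z w : cabs (z + w) <= cabs z + cabs w.
Proof. by rewrite -lecR rmorphD/= -!normC_cabs ler_normD. Qed.

Lemma cabsN z : cabs (- z) = cabs z.
Proof. by apply: (@complexI R); rewrite -!normC_cabs normrN. Qed.

Lemma cabs_Re z : `|complex.Re z| <= cabs z.
Proof. by rewrite -lecR -normC_cabs normc_ge_Re. Qed.

Lemma cabs_Im z : `|complex.Im z| <= cabs z.
Proof.
rewrite -(ger0_norm (cabs_ge0 z)) -ler_sqr ?nnegrE ?normr_ge0//.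
by rewrite !real_normK ?num_real// cabs_sqr lerDr sqr_ge0.
Qed.

Lemma cabs_le_ReIm z : cabs z <= `|complex.Re z| + `|complex.Im z|.
Proof.
rewrite -ler_sqr ?nnegrE ?cabs_ge0 ?addr_ge0// cabs_sqr.
rewrite -(real_normK (num_real (complex.Re z))).
rewrite -(real_normK (num_real (complex.Im z))).
have := normr_ge0 (complex.Re z); have := normr_ge0 (complex.Im z); nra.
Qed.

End complex_numbers.

(* Definiteness is not required: the means over a single [A n] are of this kind. *)
Definition semi_inner (R : realType) (V : lmodType R[i]) (phi : V -> V -> R[i]) :=
  [/\ forall a u v w, phi (a *: u + v) w = a * phi u w + phi v w,
      forall u v, phi v u = (phi u v)^* &
      forall u, 0 <= phi u u].

Section semi_inner.
Context (R : realType) (V : lmodType R[i]) (phi : V -> V -> R[i]).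
Hypothesis phiP : semi_inner phi.
Local Notation nrm := (ip_norm phi).

Lemma semi_inner0l v : phi 0 v = 0.
Proof.
case: phiP => + _ _ => /(_ 0 0 0 v); rewrite scaler0 addr0 mul0r add0r.
by have [+ _ _] := phiP => /(_ (-1) 0 0 v); rewrite scaler0 addr0 mulN1r addNr.
Qed.

Lemma semi_innerDl u v w : phi (u + v) w = phi u w + phi v w.
Proof. by have [H _ _] := phiP; rewrite -{1}[u]scale1r H mul1r. Qed.

Lemma semi_innerZl a u w : phi (a *: u) w = a * phi u w.
Proof. by have [H _ _] := phiP; rewrite -[_ *: _]addr0 H semi_inner0l addr0. Qed.

Lemma semi_innerNl u w : phi (- u) w = - phi u w.
Proof. by rewrite -scaleN1r semi_innerZl mulN1r. Qed.

Lemma semi_innerBl u v w : phi (u - v) w = phi u w - phi v w.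
Proof. by rewrite semi_innerDl semi_innerNl. Qed.

Lemma semi_inner_conj u v : phi v u = (phi u v)^*.
Proof. by case: phiP. Qed.

Lemma semi_innerDr u v w : phi w (u + v) = phi w u + phi w v.
Proof.
rewrite semi_inner_conj semi_innerDl rmorphD/=.
by rewrite -(semi_inner_conj u) -(semi_inner_conj v).
Qed.

Lemma semi_innerZr a u w : phi w (a *: u) = a^* * phi w u.
Proof.
by rewrite semi_inner_conj semi_innerZl rmorphM/= -(semi_inner_conj u).
Qed.

Lemma semi_innerNr u w : phi w (- u) = - phi w u.
Proof. by rewrite -scaleN1r semi_innerZr rmorphN1 mulN1r. Qed.

Lemma semi_innerBr u v w : phi w (u - v) = phi w u - phi w v.
Proof. by rewrite semi_innerDr semi_innerNr. Qed.

Lemma semi_inner_suml (I : Type) (s : seq I) (F : I -> V) w :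
  phi (\sum_(i <- s) F i) w = \sum_(i <- s) phi (F i) w.
Proof.
elim/big_ind2 : _ => // [|u1 a1 u2 a2 <- <-]; first exact: semi_inner0l.
exact: semi_innerDl.
Qed.

Lemma semi_inner_Re u : phi u u = (complex.Re (phi u u))%:C%C.
Proof. by have [_ _ /(_ u)/ger0_Im] := phiP; case: (phi u u) => a b /= ->. Qed.

Lemma semi_inner_ge0 u : 0 <= complex.Re (phi u u).
Proof. by have [_ _ /(_ u)] := phiP; rewrite semi_inner_Re lecR. Qed.

Lemma snorm_ge0 u : 0 <= nrm u. Proof. exact: sqrtr_ge0. Qed.

Lemma snorm_sqr u : nrm u ^+ 2 = complex.Re (phi u u).
Proof. by rewrite sqr_sqrtr// semi_inner_ge0. Qed.

Lemma semi_inner_snorm u : phi u u = (nrm u ^+ 2)%:C%C.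
Proof. by rewrite snorm_sqr -semi_inner_Re. Qed.

Lemma snorm_sqrD u v :
  nrm (u + v) ^+ 2 = nrm u ^+ 2 + nrm v ^+ 2 + 2 * complex.Re (phi u v).
Proof.
rewrite !snorm_sqr semi_innerDl !semi_innerDr (semi_inner_conj u v).
rewrite !addCE conjCE /=; ring.
Qed.

Lemma snormZ a u : nrm (a *: u) = cabs a * nrm u.
Proof.
apply: (@pexpIrn _ 2) => //; rewrite ?nnegrE ?mulr_ge0 ?snorm_ge0 ?cabs_ge0//.
rewrite snorm_sqr semi_innerZl semi_innerZr mulrA mul_conjC exprMn.
by rewrite semi_inner_snorm -rmorphM.
Qed.

Lemma snormN u : nrm (- u) = nrm u.
Proof. by rewrite /ip_norm semi_innerNl semi_innerNr opprK. Qed.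

Lemma snormB u v : nrm (u - v) = nrm (v - u).
Proof. by rewrite -snormN opprB. Qed.

Lemma semi_inner_CauchySchwarz u v : cabs (phi u v) <= nrm u * nrm v.
Proof.
rewrite -ler_sqr ?nnegrE ?cabs_ge0 ?mulr_ge0 ?snorm_ge0// exprMn.
(* Expand the nonnegative square of [nrm (s *: u + (t * phi u v) *: v)] for real [s], [t]: the phase
   of [phi u v] cancels against its conjugate, so only [cabs (phi u v) ^+ 2] remains. *)
have key (s t : R) : 0 <= (s * nrm u) ^+ 2 + (t * nrm v) ^+ 2 * cabs (phi u v) ^+ 2
    + 2 * s * t * cabs (phi u v) ^+ 2.
  have := sqr_ge0 (nrm (s%:C%C *: u + (t%:C%C * phi u v) *: v)).
  rewrite snorm_sqrD !snormZ !cabsM semi_innerZl semi_innerZr rmorphM/=.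
  have -> : s%:C%C * (t%:C%C^* * (phi u v)^* * phi u v) =
    (s * t * cabs (phi u v) ^+ 2)%:C%C :> R[i].
    rewrite -mulrA [_^* * phi u v]mulrC mul_conjC !rmorphM/=.
    by rewrite conjCE /= oppr0 !mulrA.
  rewrite !exprMn !cabs_sqr /= expr0n /= !addr0; lra.
have cu := snorm_ge0 u; have cv := snorm_ge0 v.
have c0 := sqr_ge0 (cabs (phi u v)).
(* A nonzero [v] may have seminorm 0, so this case is separate. There [key] is linear in [t], and
   the chosen [t] makes its right side [nrm u ^+ 2 - 2 * (1 + nrm u ^+ 2)], which is negative. *)
have [v0|v0] := eqVneq (nrm v) 0.
  rewrite v0 expr0n mulr0 leNgt; apply/negP => c_gt0.
  have := key 1 (- (1 + nrm u ^+ 2) / cabs (phi u v) ^+ 2).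
  rewrite v0 mulr0 expr0n mul0r mul1r addr0 mulr1 -mulrA divfK ?gt_eqF//.
  by have := sqr_ge0 (nrm u); nra.
have v2 : 0 < nrm v ^+ 2 by rewrite exprn_gt0// lt_neqAle eq_sym v0.
have := key (nrm v ^+ 2) (-1).
have -> : (nrm v ^+ 2 * nrm u) ^+ 2 + (-1 * nrm v) ^+ 2 * cabs (phi u v) ^+ 2 +
  2 * nrm v ^+ 2 * -1 * cabs (phi u v) ^+ 2 =
  nrm v ^+ 2 * (nrm u ^+ 2 * nrm v ^+ 2 - cabs (phi u v) ^+ 2) by ring.
by rewrite pmulr_rge0// subr_ge0.
Qed.

Lemma snormD u v : nrm (u + v) <= nrm u + nrm v.
Proof.
rewrite -ler_sqr ?nnegrE ?addr_ge0 ?snorm_ge0// snorm_sqrD.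
have := le_trans (ler_norm _) (le_trans (cabs_Re _) (semi_inner_CauchySchwarz u v)).
rewrite sqrrD; lra.
Qed.

Lemma snorm_dist u v : `|nrm u - nrm v| <= nrm (u - v).
Proof.
have := snormD (u - v) v; have := snormD (v - u) u.
by rewrite !subrK (snormB v u) ler_norml; lra.
Qed.

End semi_inner.

(** * Orthonormal families: Bessel, best approximation, Parseval *)

Section orthonormal.
Context (R : realType) (V : lmodType R[i]) (phi : V -> V -> R[i]).
Hypothesis phiP : semi_inner phi.
Context (I : choiceType) (b : I -> V).
Hypothesis bP : forall i j, phi (b i) (b j) = (i == j)%:R.
Local Notation nrm := (ip_norm phi).

(** Completing the square in the coefficients [c]. Setting [c] to the Fourier coefficients gives
    Bessel; comparing with arbitrary [c] gives best approximation. *)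
Lemma snorm_sqrB_sum (s : seq I) (c : I -> R[i]) x : uniq s ->
  nrm (x - \sum_(i <- s) c i *: b i) ^+ 2 = nrm x ^+ 2 -
    \sum_(i <- s) cabs (phi x (b i)) ^+ 2 +
    \sum_(i <- s) cabs (phi x (b i) - c i) ^+ 2.
Proof.
move=> us; set y := \sum_(i <- s) _.
have yb i : i \in s -> phi y (b i) = c i.
  move=> si; rewrite semi_inner_suml// (bigD1_seq i)//= semi_innerZl// bP eqxx.
  rewrite mulr1 big1 ?addr0// => j /negbTE ji.
  by rewrite semi_innerZl// bP ji mulr0.
have phiy z : phi y z = \sum_(i <- s) c i * phi (b i) z.
  by rewrite semi_inner_suml//; apply: eq_bigr => i _; rewrite semi_innerZl.
have yy : nrm y ^+ 2 = \sum_(i <- s) cabs (c i) ^+ 2.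
  rewrite (snorm_sqr phiP) phiy raddf_sum/= big_seq [RHS]big_seq.
  apply: eq_bigr => i si.
  by rewrite (semi_inner_conj phiP y) yb// mul_conjC.
rewrite (snorm_sqrD phiP) (snormN phiP) (semi_innerNr phiP) (semi_inner_conj phiP y).
rewrite yy phiy conjCE [complex.Re (- _)]raddfN /= raddf_sum /= mulrN mulr_sumr.
rewrite -!addrA -!sumrN -!big_split/=; congr (_ + _); apply: eq_bigr => i _.
rewrite (semi_inner_conj phiP x).
case: (phi x (b i)) (c i) => p q [p' q'].
by rewrite !cabs_sqr /=; ring.
Qed.

Lemma snorm_fourier (s : seq I) x : uniq s ->
  nrm (x - \sum_(i <- s) phi x (b i) *: b i) ^+ 2 =
  nrm x ^+ 2 - \sum_(i <- s) cabs (phi x (b i)) ^+ 2.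
Proof.
move=> us; rewrite snorm_sqrB_sum// [X in _ + X]big1 ?addr0// => i _.
by rewrite subrr cabs_sqr /= expr0n addr0.
Qed.

Lemma bessel (s : seq I) x : uniq s ->
  \sum_(i <- s) cabs (phi x (b i)) ^+ 2 <= nrm x ^+ 2.
Proof. by move=> us; rewrite -subr_ge0 -snorm_fourier// sqr_ge0. Qed.

Lemma snorm_best (s : seq I) (c : I -> R[i]) x : uniq s ->
  nrm (x - \sum_(i <- s) phi x (b i) *: b i) <= nrm (x - \sum_(i <- s) c i *: b i).
Proof.
move=> us; rewrite -ler_sqr ?nnegrE ?snorm_ge0// snorm_fourier// snorm_sqrB_sum//.
by rewrite lerDl sumr_ge0// => i _; rewrite sqr_ge0.
Qed.

Hypothesis b_dense : forall (x : V) (e : R), 0 < e ->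
  exists s : seq (R[i] * I), nrm (x - \sum_(c <- s) c.1 *: b c.2) < e.

Local Open Scope fset_scope.

Lemma fourier_tail x (e : R) : 0 < e -> exists F0 : {fset I},
  forall F : {fset I}, F0 `<=` F ->
    nrm (x - \sum_(i <- F) phi x (b i) *: b i) < e.
Proof.
move=> e0; have [s sP] := b_dense x e0.
exists [fset i in map snd s] => F /fsubsetP sF.
apply: le_lt_trans sP.
(* An index may occur several times in [s]. Its coefficients are added up, and indices of [F] absent
   from [s] get 0, so that the sum runs over a duplicate-free set and best approximation applies. *)
have -> : \sum_(c <- s) c.1 *: b c.2 =
    \sum_(i <- F) (\sum_(c <- s | c.2 == i) c.1) *: b i.
  transitivity (\sum_(c <- s) \sum_(i <- F | c.2 == i) c.1 *: b i).
    rewrite big_seq [RHS]big_seq; apply: eq_bigr => c cs.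
    rewrite (big_rem c.2) /=; last first.
      by apply: sF; rewrite inE /=; apply/mapP; exists c.
    rewrite eqxx big1_seq ?addr0// => i /andP[/eqP <-].
    by rewrite mem_rem_uniq ?fset_uniq// inE eqxx.
  under eq_bigr do rewrite big_mkcond.
  rewrite exchange_big; apply: eq_bigr => i _ /=.
  by rewrite scaler_suml -big_mkcond.
exact: snorm_best.
Qed.

Lemma parseval x :
  ((nrm x ^+ 2)%:E = \esum_(i in [set: I]) (cabs (phi x (b i)) ^+ 2)%:E)%E.
Proof.
apply/eqP; rewrite eq_le; apply/andP; split; last first.
  apply: ge_ereal_sup => _ [X [fX _] <-].
  by rewrite fsbig_finite//= sumEFin lee_fin; apply: bessel; exact: fset_uniq.
apply/lee_addgt0Pr => e e0.
(* The tolerance is [Num.sqrt e] because the squared distance is the defect in Bessel's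
   inequality. *)
have [F0 /(_ F0 (fsubset_refl _)) F0P] :=
  @fourier_tail x (Num.sqrt e) ltac:(by rewrite sqrtr_gt0).
have := ltW F0P; rewrite -ler_sqr ?nnegrE ?snorm_ge0 ?sqrtr_ge0//.
rewrite snorm_fourier ?fset_uniq// (sqr_sqrtr (ltW e0)) lerBlDl => F0e.
apply: (@le_trans _ _ (\sum_(i <- F0) cabs (phi x (b i)) ^+ 2 + e)%:E).
  by rewrite lee_fin.
rewrite EFinD leeD2r// esum_ge//; exists [set` F0].
  by split => //; exact: finite_fset.
by rewrite fsbig_finite//= set_fsetK sumEFin.
Qed.

(** Let the finite set [F n] bring the Fourier sum within 1/(n+1) of [x]. Bessel on [i :: F n]
    bounds the coefficient at any [i] outside [F n] by that distance, so every nonzero coefficient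
    has its index in the union of the [F n]. *)
Lemma countable_fourier x : countable [set i | phi x (b i) != 0].
Proof.
have e0 n : 0 < n.+1%:R^-1 :> R by rewrite invr_gt0.
pose F n : {fset I} := projT1 (cid (fourier_tail x (e0 n))).
have FP n := projT2 (cid (fourier_tail x (e0 n))).
apply: (@sub_countable _ _ _ (\bigcup_n [set` F n])); last first.
  by apply: bigcup_countable => // n _; exact/finite_set_countable/finite_fset.
apply: subset_card_le => i /=; apply: contra_neqP => iF.
apply/eqP; rewrite -cabs_sqr_eq0 eq_le sqr_ge0 andbT leNgt; apply/negP => ai.
have [n nai] : exists n, n.+1%:R^-1 < cabs (phi x (b i)).
  have ai0 : 0 < cabs (phi x (b i)).
    by rewrite lt_neqAle cabs_ge0 andbT eq_sym -sqrf_eq0 gt_eqF.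
  exists (Num.truncn (cabs (phi x (b i)))^-1).
  by rewrite invf_plt ?posrE// truncnS_gt.
have iFn : i \notin F n by apply/negP => iFn; apply: iF; exists n.
have := bessel x (s := i :: F n); rewrite /= iFn fset_uniq => /(_ erefl).
rewrite big_cons -lerBrDr -snorm_fourier ?fset_uniq//.
rewrite leNgt => /negP; apply.
rewrite ltr_sqr ?nnegrE ?snorm_ge0 ?cabs_ge0//.
exact: lt_trans (FP n _ (fsubset_refl _)) nai.
Qed.

End orthonormal.

(** * Complex-valued limits and integrals *)

Section complex_limits.
Context {R : realType}.

(* The argument types force the ring operations of [u] and [l] to be those of
   [R[i]] rather than those of the normed module [R[i]^o], whose unification
   diverges. *)
Definition cvgC (u : nat -> R[i]) (l : R[i]) : Prop :=
  (u : nat -> R[i]^o) @ \oo --> (l : R[i]^o).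

Lemma cvgC_ReIm (u : nat -> R[i]) (l : R[i]) :
  complex.Re (u n) @[n --> \oo] --> complex.Re l ->
  complex.Im (u n) @[n --> \oo] --> complex.Im l -> cvgC u l.
Proof.
move=> /cvgrPdist_lt uR /cvgrPdist_lt uI; apply/cvgrPdist_lt => e e0.
(* A complex [e] with [0 < e] is real, by the definition of the order on [R[i]]. *)
have er : e = (complex.Re e)%:C%C by case: e e0 => a b; rewrite ltcE/= => /andP[/eqP ->].
have e2 : 0 < complex.Re e / 2 by move: e0; rewrite er ltcR => e0; rewrite divr_gt0.
near=> n.
rewrite er normC_cabs ltcR (le_lt_trans (cabs_le_ReIm _))// (splitr (complex.Re e)).
rewrite !raddfB/= ltrD//.
  by near: n; exact: uR.
by near: n; exact: uI.
Unshelve. all: end_near. Qed.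

Lemma cvgC_Re (u : nat -> R[i]) (l : R[i]) :
  cvgC u l -> complex.Re (u n) @[n --> \oo] --> complex.Re l.
Proof. by move=> ul; apply: (cvg_comp _ _ ul); exact: continuous_Re. Qed.

Lemma cvgC_Im (u : nat -> R[i]) (l : R[i]) :
  cvgC u l -> complex.Im (u n) @[n --> \oo] --> complex.Im l.
Proof. by move=> ul; apply: (cvg_comp _ _ ul); exact: continuous_Im. Qed.

Lemma cvgC_unique (u : nat -> R[i]) (a b : R[i]) : cvgC u a -> cvgC u b -> a = b.
Proof.
move=> ua ub; have aR := cvgC_Re ua; have aI := cvgC_Im ua.
have bR := cvgC_Re ub; have bI := cvgC_Im ub.
apply/eqP; rewrite eq_complex; apply/andP; split; apply/eqP.
  exact: (cvg_unique (@Rhausdorff R) aR bR).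
exact: (cvg_unique (@Rhausdorff R) aI bI).
Qed.

Lemma cvgC_conj (u : nat -> R[i]) (l : R[i]) :
  cvgC u l -> cvgC (fun n => (u n)^* ) l^*.
Proof.
move=> ul; apply: cvgC_ReIm; rewrite conjCE /=.
  by under eq_cvg do rewrite /= conjCE /=; exact: cvgC_Re.
by under eq_cvg do rewrite /= conjCE /=; apply: cvgN; exact: cvgC_Im.
Qed.

Lemma cvgC_cst (l : R[i]) : cvgC (fun=> l) l.
Proof. exact: cvg_cst. Qed.

Lemma cvgCD (u v : nat -> R[i]) (a b : R[i]) :
  cvgC u a -> cvgC v b -> cvgC (fun n => u n + v n) (a + b).
Proof.
move=> ua vb; have uR := cvgC_Re ua; have uI := cvgC_Im ua.
have vR := cvgC_Re vb; have vI := cvgC_Im vb.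
apply: cvgC_ReIm; rewrite addCE /=; under eq_cvg do rewrite addCE /=; exact: cvgD.
Qed.

Lemma cvgCM (u v : nat -> R[i]) (a b : R[i]) :
  cvgC u a -> cvgC v b -> cvgC (fun n => u n * v n) (a * b).
Proof.
move=> ua vb; have uR := cvgC_Re ua; have uI := cvgC_Im ua.
have vR := cvgC_Re vb; have vI := cvgC_Im vb.
apply: cvgC_ReIm; rewrite mulCE /=; under eq_cvg do rewrite mulCE /=.
  by apply: cvgB; exact: cvgM.
by apply: cvgD; exact: cvgM.
Qed.

Lemma cvgC_sum (I : Type) (s : seq I) (u : I -> nat -> R[i]) (l : I -> R[i]) :
  (forall i, cvgC (u i) (l i)) ->
  cvgC (fun n => \sum_(i <- s) u i n) (\sum_(i <- s) l i).
Proof.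
move=> ul; elim: s => [|i s IH].
  by rewrite big_nil; under [X in cvgC X]funext do rewrite big_nil; exact: cvgC_cst.
rewrite big_cons; under [X in cvgC X]funext do rewrite big_cons.
exact: cvgCD.
Qed.

Lemma cvgC_cabs0 (u : nat -> R[i]) : cabs (u n) @[n --> \oo] --> 0 -> cvgC u 0.
Proof.
move=> u0; apply: cvgC_ReIm => /=; apply: norm_cvg0;
  apply: (squeeze_cvgr _ (cvg_cst 0) u0); apply: nearW => n;
  by rewrite normr_ge0 ?cabs_Re ?cabs_Im.
Qed.

End complex_limits.

(** * Integration of complex-valued functions *)

Section complex_integral.
Context d (T : measurableType d) (R : realType) (mu : {measure set T -> \bar R}).
Implicit Types (D : set T) (f g : T -> R[i]).

Definition cintegrable D f :=
  mu.-integrable D (fun t => (complex.Re (f t))%:E) /\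
  mu.-integrable D (fun t => (complex.Im (f t))%:E).

Definition cint D f : R[i] :=
  Complex (\int[mu]_(t in D) complex.Re (f t)) (\int[mu]_(t in D) complex.Im (f t)).

Lemma cint_lincomb D (a : R[i]) f g : measurable D ->
  cintegrable D f -> cintegrable D g ->
  cintegrable D (fun t => a * f t + g t) /\
  cint D (fun t => a * f t + g t) = a * cint D f + cint D g.
Proof.
move=> mD [fR fI] [gR gI].
have EZ (h : T -> R) (r : R) : mu.-integrable D (EFin \o h) ->
    mu.-integrable D (EFin \o (fun t => r * h t)).
  move=> ih; have -> : EFin \o (fun t => r * h t) = (fun t => r%:E * (h t)%:E)%E.
    by apply/funext => t; rewrite /= EFinM.
  exact: integrableZl.
have ED (h k : T -> R) : mu.-integrable D (EFin \o h) ->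
    mu.-integrable D (EFin \o k) -> mu.-integrable D (EFin \o (fun t => h t + k t)).
  by move=> ih ik; exact: (integrableD mD ih ik).
have EB (h k : T -> R) : mu.-integrable D (EFin \o h) ->
    mu.-integrable D (EFin \o k) -> mu.-integrable D (EFin \o (fun t => h t - k t)).
  by move=> ih ik; exact: (integrableB mD ih ik).
have E t : a * f t + g t = Complex
   (complex.Re a * complex.Re (f t) - complex.Im a * complex.Im (f t)
     + complex.Re (g t))
   (complex.Re a * complex.Im (f t) + complex.Im a * complex.Re (f t)
     + complex.Im (g t)).
  by rewrite addCE mulCE.
split; first split.
- under eq_fun do rewrite E /=.
  by apply/ED => //; apply/EB; exact/EZ.
- under eq_fun do rewrite E /=.
  by apply/ED => //; apply/ED; exact/EZ.
- rewrite addCE mulCE /cint; congr Complex; under eq_Rintegral do rewrite E /=.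
    rewrite /= RintegralD//; last by apply: EB; exact: EZ.
    by rewrite RintegralB ?RintegralZl//; exact: EZ.
  rewrite /= RintegralD//; last by apply: ED; exact: EZ.
  by rewrite RintegralD ?RintegralZl//; exact: EZ.
Qed.

Lemma cint_conj D f : measurable D -> cintegrable D f ->
  cint D (fun t => (f t)^* ) = (cint D f)^*.
Proof.
move=> mD [fR fI]; rewrite conjCE /cint; congr Complex.
  by apply: eq_Rintegral => t _; rewrite conjCE.
rewrite -mulN1r -RintegralZl//; apply: eq_Rintegral => t _.
by rewrite conjCE mulN1r.
Qed.

Definition sqr_integrable D f :=
  [/\ measurable_fun D (fun t => complex.Re (f t)),
      measurable_fun D (fun t => complex.Im (f t)) &
      (\int[mu]_(t in D) (cabs (f t) ^+ 2)%:E < +oo)%E].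

Lemma sqr_integrable_mul_conj D f g : measurable D ->
  sqr_integrable D f -> sqr_integrable D g ->
  cintegrable D (fun t => f t * (g t)^* ).
Proof.
move=> mD [fR fI f2] [gR gI g2].
have intsq h : sqr_integrable D h ->
    mu.-integrable D (fun t => (cabs (h t) ^+ 2)%:E).
  case=> hR hI h2; apply/integrableP; split.
    apply/measurable_EFinP; under eq_fun do rewrite cabs_sqr.
    by apply: measurable_funD; exact: (measurable_funX 2).
  rewrite (eq_integral (fun t => (cabs (h t) ^+ 2)%:E))// => t _.
    by rewrite gee0_abs// lee_fin sqr_ge0.
have ifg := integrableD mD (intsq _ (And3 fR fI f2)) (intsq _ (And3 gR gI g2)).
(* The integrable dominating function for both the real and the imaginary part. *)
have bnd t : cabs (f t * (g t)^* ) <= cabs (f t) ^+ 2 + cabs (g t) ^+ 2.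
  rewrite cabsM cabs_conj.
  by have := cabs_ge0 (f t); have := cabs_ge0 (g t); nra.
have E t : f t * (g t)^* = Complex
   (complex.Re (f t) * complex.Re (g t) + complex.Im (f t) * complex.Im (g t))
   (complex.Im (f t) * complex.Re (g t) - complex.Re (f t) * complex.Im (g t)).
  by rewrite mulCE conjCE /=; congr Complex; ring.
split; apply: (le_integrable mD _ _ ifg).
- apply/measurable_EFinP; under eq_fun do rewrite E /=.
  by apply: measurable_funD; exact: measurable_funM.
- move=> t _ /=; rewrite lee_fin [leRHS]ger0_norm ?addr_ge0 ?sqr_ge0//.
  exact: le_trans (cabs_Re _) (bnd t).
- apply/measurable_EFinP; under eq_fun do rewrite E /=.
  by apply: measurable_funB; exact: measurable_funM.
- move=> t _ /=; rewrite lee_fin [leRHS]ger0_norm ?addr_ge0 ?sqr_ge0//.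
  exact: le_trans (cabs_Im _) (bnd t).
Qed.

Lemma cint_sqr D f :
  cint D (fun t => f t * (f t)^* ) = (\int[mu]_(t in D) (cabs (f t) ^+ 2))%:C%C.
Proof.
rewrite /cint; congr Complex.
  by apply: eq_Rintegral => t _; rewrite mul_conjC.
rewrite /Rintegral integral0_eq// => t _.
by rewrite mul_conjC.
Qed.

End complex_integral.

(** * Means along a van Hove sequence *)

Section mean_form.
Context (R : realType) (G : lcaGroupType) (mu : haar_measure R G).
Context (A : van_hove_sequence mu).

Lemma vh_measurable n : measurable (A n : set (borel G)).
Proof. by apply: borel_open; exact: vh_open. Qed.

Lemma vh_sub_compact n : exists2 K : set G, compact K & A n `<=` K.
Proof.
exists (closure (A n)); last exact: subset_closure.
by rewrite -precompactE; exact: vh_precompact.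
Qed.

Lemma vh_ltoo n : (mu (A n) < +oo)%E.
Proof.
have [K cK AK] := vh_sub_compact n.
apply: le_lt_trans (haar_compact mu cK).
by apply: le_measure => //; rewrite inE; [exact: vh_measurable|exact: borel_compact].
Qed.

Lemma vh_fin_num n : mu (A n) \is a fin_num.
Proof. by rewrite ge0_fin_numE// vh_ltoo. Qed.

Lemma vh_fine_gt0 n : 0 < fine (mu (A n)).
Proof. by rewrite fine_gt0// vh_gt0 vh_ltoo. Qed.

Lemma L2loc_sqr_integrable (f : G -> R[i]) n :
  L2loc mu f -> sqr_integrable mu (A n : set (borel G)) f.
Proof.
move=> lf; have [fr fi fK] := lf; split.
- exact: measurable_funS fr.
- exact: measurable_funS fi.
- have [K cK AK] := vh_sub_compact n; apply: le_lt_trans (fK K cK).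
  apply: ge0_subset_integral => //.
  + exact: vh_measurable.
  + exact: borel_compact.
  + exact: measurable_cabs_sqr lf.
  + by move=> t _; rewrite lee_fin sqr_ge0.
Qed.

Lemma besi_L2loc (f : besi A) : L2loc mu f.
Proof. by have /asboolP[] := besi_subproof f. Qed.

Lemma mean_cint (f : G -> R[i]) n :
  mean A f n = ((fine (mu (A n)))^-1)%:C%C * cint mu (A n : set (borel G)) f.
Proof. by []. Qed.

Definition mean_ip n (f g : besi A) : R[i] := mean A (fun t => f t * (g t)^* ) n.

Lemma besi_mul_conj_cintegrable (f g : besi A) n :
  cintegrable mu (A n : set (borel G)) (fun t => f t * (g t)^* ).
Proof.
apply: sqr_integrable_mul_conj; first exact: vh_measurable.
  exact/L2loc_sqr_integrable/besi_L2loc.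
exact/L2loc_sqr_integrable/besi_L2loc.
Qed.

Lemma mean_ip_ffE n (f : besi A) :
  mean_ip n f f = (fine (mean_sqr A f n))%:C%C.
Proof.
rewrite /mean_ip mean_cint cint_sqr -rmorphM/= /mean_sqr fineM//.
have [_ _ H] := L2loc_sqr_integrable n (besi_L2loc f).
by rewrite ge0_fin_numE//; apply: integral_ge0 => t _; rewrite lee_fin sqr_ge0.
Qed.

Lemma mean_ip_semi_inner n : semi_inner (mean_ip n).
Proof.
have mA := vh_measurable n; split=> [a u v w|u v|u].
- rewrite /mean_ip !mean_cint [RHS]addrC mulrCA addrC -mulrDr; congr (_ * _).
  have [_ <-] := cint_lincomb a mA (besi_mul_conj_cintegrable u w n)
    (besi_mul_conj_cintegrable v w n).
  congr cint; apply/funext => t.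
  by rewrite mulrA -mulrDl.
- rewrite /mean_ip !mean_cint rmorphM/= -cint_conj//; last first.
    exact: besi_mul_conj_cintegrable.
  congr (_ * _); first by rewrite conjCE /= oppr0.
  congr cint; apply/funext => t.
  by rewrite rmorphM/= conjCK mulrC.
- by rewrite mean_ip_ffE lecR fine_ge0// mean_sqr_ge0.
Qed.

Lemma mean_sqrE (f : besi A) n :
  mean_sqr A f n = ((ip_norm (mean_ip n) f) ^+ 2)%:E.
Proof.
rewrite (snorm_sqr (mean_ip_semi_inner n)) mean_ip_ffE /= fineK//.
have [_ _ H] := L2loc_sqr_integrable n (besi_L2loc f).
rewrite /mean_sqr fin_numM// ge0_fin_numE//.
by apply: integral_ge0 => t _; rewrite lee_fin sqr_ge0.
Qed.

End mean_form.

(** * Translations and Borel sets *)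

Section characters.
Context (R : realType) (G : lcaGroupType) (mu : haar_measure R G).
Context (A : van_hove_sequence mu).

Lemma continuousD_cst (t : G) : continuous (fun x : G => x + t).
Proof.
move=> x; apply: (@cvg_comp _ _ _ (fun y : G => (y, t)) (fun z : G * G => z.1 + z.2)
  _ (nbhs (x, t))); last exact: (@add_continuous G (x, t)).
apply: cvg_pair; [exact: cvg_id|exact: cvg_cst].
Qed.

Lemma image_addr (t : G) (E : set G) :
  [set t + y | y in E] = (fun x => x - t) @^-1` E.
Proof.
apply/seteqP; split=> [_ [y Ey <-]|x /= Ex]; first by rewrite /= addrAC subrr add0r.
by exists (x - t) => //; rewrite addrC subrK.
Qed.

Lemma measurable_fun_translate (t : G) :
  measurable_fun [set: borel G] ((fun x : G => x + t) : borel G -> borel G).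
Proof.
apply: (@measurability _ _ (borel G) (borel G) setT _ (@open G)) => //.
move=> _ [U oU <-]; rewrite setTI; apply: borel_open.
by apply: open_comp => // x _; exact: continuousD_cst.
Qed.

(** Change of variables: the pushforward of [mu] under [x + t] is [mu] by translation invariance,
    and the preimage of the translated set is [E]. *)
Lemma integral_translate (t : G) (E : set (borel G)) (f : borel G -> \bar R) :
  measurable E -> measurable_fun [set: borel G] f ->
  mu.-integrable E (fun x : G => f (x + t)) ->
  (\int[mu]_(x in ([set t + y | y in (E : set G)]%R : set (borel G))) f x =
   \int[mu]_(x in E) f ((x : G) + t)%R)%E.
Proof.
move=> mE mf intf.
have mphi := measurable_fun_translate t.
have mtE : measurable ([set t + y | y in (E : set G)] : set (borel G)).
  rewrite image_addr -[X in measurable X]setTI.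
  exact: (measurable_fun_translate (- t) measurableT).
have preE : ((fun x : G => x + t) : borel G -> borel G) @^-1` [set t + y | y in (E : set G)] = E.
  rewrite image_addr -comp_preimage; apply/seteqP.
  by split=> x; rewrite /preimage /= addrK.
have := integral_pushforward mphi mf _ mtE; rewrite preE => <- //.
apply: eq_measure_integral => B mB _ /=.
rewrite /pushforward -(haar_translation mu (- t) mB) image_addr.
by congr (mu _); apply/seteqP; split=> x; rewrite /preimage /= opprK.
Qed.

Lemma borel_closed (C : set G) : closed C -> measurable (C : set (borel G)).
Proof.
move=> cC; rewrite -(setCK (C : set (borel G))); apply: measurableC.
by apply: borel_open; exact: closed_openC.
Qed.

Lemma vh_boundary_closed (K B : set G) : closed (vh_boundary K B).
Proof. by apply: closedU; apply: closedI; exact: closed_closure. Qed.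

End characters.

(** * Integrals of bounded functions over nearby sets *)

Section bounded_integral.
Context d (T : measurableType d) (R : realType) (mu : {measure set T -> \bar R}).
Implicit Types (B C : set T) (f : T -> R).

Lemma bounded_integrable B f : measurable B -> (mu B < +oo)%E ->
  measurable_fun [set: T] f -> (forall t, `|f t| <= 1) ->
  mu.-integrable B (EFin \o f).
Proof.
move=> mB Boo mf f1; apply: measurable_bounded_integrable => //.
  exact: measurable_funS mf.
by exists 1; split => // x x1 t _; apply: le_trans (f1 t) (ltW x1).
Qed.

Lemma Rintegral_bounded B f : measurable B -> (mu B < +oo)%E ->
  measurable_fun [set: T] f -> (forall t, `|f t| <= 1) ->
  `|\int[mu]_(t in B) f t| <= fine (mu B).
Proof.
move=> mB Boo mf f1.
apply: le_trans (le_normr_Rintegral mB (bounded_integrable mB Boo mf f1)) _.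
rewrite -[leRHS]mul1r -(Rintegral_cst mu mB 1).
apply: le_Rintegral => //.
- apply: (@bounded_integrable B (fun t => `|f t|)) => //.
    exact: measurableT_comp.
  by move=> t; rewrite normr_id.
- apply: (@bounded_integrable B (cst 1)) => // t.
  by rewrite normr1.
Qed.

(** The contributions of the intersection of [B] and [C] cancel; on the two differences the
    integrand is bounded by 1. *)
Lemma Rintegral_setD_le B C f : measurable B -> measurable C ->
  (mu B < +oo)%E -> (mu C < +oo)%E ->
  measurable_fun [set: T] f -> (forall t, `|f t| <= 1) ->
  `|\int[mu]_(t in B) f t - \int[mu]_(t in C) f t| <=
  fine (mu (B `\` C)) + fine (mu (C `\` B)).
Proof.
move=> mB mC Boo Coo mf f1.
have split_int X Y : measurable X -> measurable Y -> (mu X < +oo)%E ->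
    \int[mu]_(t in X) f t = \int[mu]_(t in X `&` Y) f t + \int[mu]_(t in X `\` Y) f t.
  move=> mX mY Xoo; rewrite -[X in LHS](setUIDK X Y) Rintegral_setU//.
  - exact: measurableI.
  - exact: measurableD.
  - by rewrite setUIDK; exact: bounded_integrable.
  - by apply/disj_setPS => t [[_ ?] []].
have D_ltoo X Y : measurable X -> measurable Y -> (mu X < +oo)%E ->
    (mu (X `\` Y) < +oo)%E.
  move=> mX mY; apply: le_lt_trans; apply: le_measure; rewrite ?inE//.
  exact: measurableD.
rewrite (split_int B C)// (split_int C B)// [C `&` B]setIC.
rewrite opprD addrACA subrr add0r (le_trans (ler_normB _ _))// lerD//.
  by apply: Rintegral_bounded => //; [exact: measurableD|exact: D_ltoo].
by apply: Rintegral_bounded => //; [exact: measurableD|exact: D_ltoo].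
Qed.

End bounded_integral.

(** * Vanishing means of nontrivial characters *)

Section character_means.
Context (R : realType) (G : lcaGroupType) (mu : haar_measure R G).
Context (A : van_hove_sequence mu).
Implicit Type chi : dual R G.

Lemma dualP chi : is_character chi.
Proof. exact/asboolP/dual_subproof. Qed.

Lemma cabs_dual chi t : cabs (chi t) = 1.
Proof. by have [_ _ n1] := dualP chi; rewrite /cabs n1. Qed.

(** The points gained by translating [A n] lie in the first half of the van Hove boundary for the
    compact set [[set t]]; the points lost lie in the second half for [[set - t]]. *)
Lemma vh_translate_cvg0 (t : G) :
  (fine (mu ([set t + y | y in A n] `\` A n)) / fine (mu (A n)) @[n --> \oo] --> 0) /\
  (fine (mu (A n `\` [set t + y | y in A n])) / fine (mu (A n)) @[n --> \oo] --> 0).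
Proof.
have mtA n : measurable ([set t + y | y in A n] : set (borel G)).
  rewrite image_addr -[X in measurable X]setTI.
  exact: (measurable_fun_translate (- t) measurableT (vh_measurable A n)).
have sub1 n : [set t + y | y in A n] `\` A n `<=` vh_boundary [set t] (A n).
  move=> _ [[y Ay <-] tyA]; left; split; last exact: subset_closure.
  by apply: subset_closure; exists y => //; exists t => //; rewrite addrC.
have sub2 n : A n `\` [set t + y | y in A n] `<=` vh_boundary [set - t] (A n).
  move=> y [Ay tyA]; right; split; last exact: subset_closure.
  apply: subset_closure; exists (y - t); last by exists (- t) => //; rewrite opprK subrK.
  by move=> yt; apply: tyA; exists (y - t) => //; rewrite addrC subrK.
have key (s : G) (B : nat -> set (borel G)) : (forall n, measurable (B n)) ->
    (forall n, B n `<=` vh_boundary [set s] (A n)) ->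
    fine (mu (B n)) / fine (mu (A n)) @[n --> \oo] --> 0.
  move=> mB sB.
  have H : (mu (B n) * ((fine (mu (A n)))^-1)%:E)%E @[n --> \oo] --> 0%E.
    have cs : compact [set s] by exact: compact_set1.
    apply: (squeeze_cvge _ (cvg_cst 0%E) (vh_cvg A cs)).
    apply: nearW => n; apply/andP; split.
      by rewrite mule_ge0// lee_fin invr_ge0 fine_ge0.
    rewrite lee_wpmul2r ?lee_fin ?invr_ge0 ?fine_ge0//.
    apply: le_measure; rewrite ?inE; [exact: mB| |exact: sB].
    by apply: borel_closed; exact: vh_boundary_closed.
  (* [fine] is multiplicative only on finite factors. Eventually the quotient is finite, and since
     [A n] has positive volume this forces [mu (B n)] to be finite. *)
  apply: cvg_trans (fine_cvg H); apply: near_eq_cvg.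
  have [Hfin _] := (fine_cvgP _ _).1 H.
  near=> n => /=.
  have Hn : (mu (B n) * ((fine (mu (A n)))^-1)%:E)%E \is a fin_num by near: n.
  rewrite fineM//; move: Hn; rewrite ge0_fin_numE; last first.
    by rewrite mule_ge0// lee_fin invr_ge0 fine_ge0.
  move=> Hn; rewrite ge0_fin_numE// ltey; apply/eqP => Boo.
  by move: Hn; rewrite Boo gt0_mulye ?ltxx// lte_fin invr_gt0 vh_fine_gt0.
split.
- by apply: (key t) => n; [apply: measurableD => //; exact: vh_measurable|exact: sub1].
- by apply: (key (- t)) => n; [apply: measurableD => //; exact: vh_measurable|exact: sub2].
Unshelve. all: end_near. Qed.

Lemma dual_measurable chi :
  measurable_fun [set: borel G] (fun t => complex.Re (chi t)) /\
  measurable_fun [set: borel G] (fun t => complex.Im (chi t)).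
Proof. by have [] := L2loc_character mu chi. Qed.

(** Translating [A n] by [t] multiplies the integral of [chi] by [chi t], yet changes it by no more
    than a multiple of the volume of the symmetric difference. Hence [cabs (chi t - 1)] times the
    mean tends to 0. *)
Lemma mean_dual_cvg0 chi t : chi t != 1 ->
  cvgC (mean A chi) 0.
Proof.
move=> chit1.
have [mR mI] := dual_measurable chi.
have R1 x : `|complex.Re (chi x)| <= 1 by rewrite -(cabs_dual chi x) cabs_Re.
have I1 x : `|complex.Im (chi x)| <= 1 by rewrite -(cabs_dual chi x) cabs_Im.
have mtA n : measurable ([set t + y | y in A n] : set (borel G)).
  rewrite image_addr -[X in measurable X]setTI.
  exact: (measurable_fun_translate (- t) measurableT (vh_measurable A n)).
have tAoo n : (mu ([set (t + y)%R | y in A n] : set (borel G)) < +oo)%E.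
  by rewrite haar_translation ?vh_ltoo//; exact: vh_measurable.
have chi_int n : cintegrable mu (A n : set (borel G)) chi.
  by split; apply: bounded_integrable => //; do ?[exact: vh_measurable|exact: vh_ltoo].
have trans n : cint mu ([set t + y | y in A n] : set (borel G)) chi =
    chi t * cint mu (A n : set (borel G)) chi.
  have [_ chiM _] := dualP chi.
  have z_int : cintegrable mu (A n : set (borel G)) (fun=> 0).
    by split; exact: integrable0.
  have [[iR iI] E] := cint_lincomb (chi t) (vh_measurable A n) (chi_int n) z_int.
  have chiE x : chi t * chi x + 0 = chi (x + t) by rewrite addr0 chiM mulrC.
  rewrite -[RHS]addr0.
  have <- : cint mu (A n : set (borel G)) (fun=> 0) = 0.
    by rewrite /cint /Rintegral !integral0.
  rewrite -E; congr Complex.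
    rewrite /Rintegral integral_translate//.
    - by congr fine; apply: eq_integral => x _; rewrite chiE.
    - exact: vh_measurable.
    - exact/measurable_EFinP.
    - by move: iR; under eq_fun do rewrite chiE.
  rewrite /Rintegral integral_translate//.
  - by congr fine; apply: eq_integral => x _; rewrite chiE.
  - exact: vh_measurable.
  - exact/measurable_EFinP.
  - by move: iI; under eq_fun do rewrite chiE.
have [c1 c2] := vh_translate_cvg0 t.
have chit0 : 0 < cabs (chi t - 1).
  by rewrite lt_neqAle cabs_ge0 andbT eq_sym -sqrf_eq0 cabs_sqr_eq0 subr_eq0.
apply: cvgC_cabs0.
(* The factor 2 comes from estimating the real and imaginary parts separately. *)
have c12 : (fine (mu ([set t + y | y in A n] `\` A n)) / fine (mu (A n)) +
    fine (mu (A n `\` [set t + y | y in A n])) / fine (mu (A n))) * 2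
    / cabs (chi t - 1) @[n --> \oo] --> 0.
  rewrite -(mul0r (cabs (chi t - 1))^-1) -[X in X * _ ](mul0r 2).
  rewrite -[X in X * _ * _](addr0 0).
  by apply: cvgM; [apply: cvgM; [exact: cvgD|exact: cvg_cst]|exact: cvg_cst].
apply: (squeeze_cvgr _ (cvg_cst 0) c12).
apply: nearW => n; rewrite cabs_ge0/= -mulrDl ler_pdivlMr//.
rewrite -cabsM mean_cint mulrBr mulr1 [_ * chi t]mulrC mulrCA -trans -mulrBr cabsM.
have -> : cabs ((fine (mu (A n)))^-1)%:C%C = (fine (mu (A n)))^-1.
  by rewrite /cabs ger0_norm// lecR invr_ge0 ltW// vh_fine_gt0.
rewrite mulrAC [leRHS]mulrC ler_pM2l ?invr_gt0 ?vh_fine_gt0//.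
apply: le_trans (cabs_le_ReIm _) _; rewrite mulr_natr mulr2n !raddfB/=.
by apply: lerD; apply: Rintegral_setD_le => //;
  do ?[exact: vh_measurable|exact: vh_ltoo].
Qed.

End character_means.

(** * The limit inner product *)

Section limit_form.
Context (R : realType) (G : lcaGroupType) (mu : haar_measure R G).
Context (A : van_hove_sequence mu).

(** Conjugation inverts numbers of modulus 1, so this is the quotient of [chi] by [psi] in the dual
    group; its mean is the inner product of the two characters. *)
Lemma dual_div_subproof (chi psi : dual R G) :
  `[< is_character (fun t => chi t * (psi t)^* ) >].
Proof.
have [cchi chiM chi1] := dualP chi; have [cpsi psiM psi1] := dualP psi.
apply/asboolP; split=> [t|s t|t].
- apply: (@cvgM _ _ _ _ (chi : G -> R[i]^o) (fun t => (psi t)^* : R[i]^o)).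
    exact: cchi.
  apply: (@continuous_comp G R[i]^o R[i]^o psi (fun z => z^* )); first exact: cpsi.
  move=> P /nbhs_ballP[e/= e0 eP]; apply/nbhs_ballP; exists e => // w.
  rewrite /ball/= => zw; apply: eP; rewrite /ball/=.
  by rewrite -rmorphB norm_conjC.
- by rewrite chiM psiM rmorphM mulrACA.
- by rewrite normrM norm_conjC chi1 psi1 mulr1.
Qed.

Definition dual_div (chi psi : dual R G) : dual R G :=
  Dual (dual_div_subproof chi psi).

Lemma mean_ip_char_diag n (chi : dual R G) :
  mean_ip n (besi_char A chi) (besi_char A chi) = 1.
Proof.
rewrite mean_ip_ffE /mean_sqr; under eq_integral do rewrite cabs_dual expr1n.
rewrite integral_cst; last exact: vh_measurable.
rewrite mul1e -[mu (A n)]fineK ?vh_fin_num//.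
by rewrite -EFinM /= mulVf ?gt_eqF ?vh_fine_gt0.
Qed.

Lemma mean_ip_char_cvg (chi psi : dual R G) :
  cvgC (fun n => mean_ip n (besi_char A chi) (besi_char A psi)) (chi == psi)%:R.
Proof.
have [<-|chipsi] := eqVneq chi psi.
  rewrite (_ : (fun _ => _) = fun=> 1); first exact: cvgC_cst.
  by apply/funext => n; rewrite mean_ip_char_diag.
(* If the quotient were identically 1, multiplying by [psi] would give [chi = psi]. *)
have [t chit] : exists t, dual_div chi psi t != 1.
  apply: contrapT => /forallNP H; move/eqP: chipsi; apply.
  apply/val_inj/funext => t; have /negP/negPn/eqP /= := H t => chi1.
  have [_ _ /(_ t) psi1] := dualP psi.
  by rewrite -[LHS]mulr1 -[1](expr1n _ 2) -psi1 normCK [psi t * _]mulrC mulrA chi1 mul1r.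
exact: (mean_dual_cvg0 A chit).
Qed.

Definition besi_trig (s : seq (R[i] * dual R G)) : besi A :=
  \sum_(c <- s) c.1 *: besi_char A c.2.

Lemma besi_trigE s :
  (besi_trig s : G -> R[i]) = \sum_(c <- s) c.1 *: (c.2 : G -> R[i]).
Proof. by rewrite /besi_trig; elim/big_ind2 : _ => // _ f _ g <- <-. Qed.

Lemma besi_approx (f : besi A) (e : R) : 0 < e ->
  exists s, (besi_norm A (f - besi_trig s)%R < e%:E)%E.
Proof.
move=> e0; have /asboolP[_ /(_ e e0)[_ [[s ->] Pe]]] := besi_subproof f.
by exists s; move: Pe; rewrite -besi_trigE.
Qed.

Lemma mean_ip_trig_cvg s : exists l : R[i],
  cvgC (fun n => mean_ip n (besi_trig s) (besi_trig s)) l.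
Proof.
exists (\sum_(c <- s) \sum_(d <- s) c.1 * (d.1^* * (c.2 == d.2)%:R)).
have -> : (fun n => mean_ip n (besi_trig s) (besi_trig s)) =
   (fun n => \sum_(c <- s) \sum_(d <- s)
      c.1 * (d.1^* * mean_ip n (besi_char A c.2) (besi_char A d.2))).
  apply/funext => n; have nP := mean_ip_semi_inner A n.
  rewrite (semi_inner_suml nP); apply: eq_bigr => c _.
  rewrite (semi_innerZl nP) (semi_inner_conj nP) (semi_inner_suml nP).
  rewrite rmorph_sum/= mulr_sumr; apply: eq_bigr => d _.
  by rewrite (semi_innerZl nP) rmorphM/= -(semi_inner_conj nP).
apply: cvgC_sum => c; apply: cvgC_sum => d.
apply: cvgCM; first exact: cvgC_cst.
by apply: cvgCM; [exact: cvgC_cst|exact: mean_ip_char_cvg].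
Qed.

Lemma snorm_near_lt (f : besi A) (e : R) : 0 < e -> (besi_norm A f < e%:E)%E ->
  \forall n \near \oo, ip_norm (mean_ip n) f <= e.
Proof.
move=> e0 /(besi_norm_lt e0); apply: filterS => n.
rewrite mean_sqrE lee_fin ler_sqr ?nnegrE ?snorm_ge0 ?(ltW e0)//.
Qed.

(** Cauchy criterion: [f] is within [e / 2] of a trigonometric polynomial in all seminorms of large
    index, the seminorms of the polynomial converge, and the reverse triangle inequality compares
    the two. *)
Lemma mean_snorm_is_cvg (f : besi A) : cvgn (fun n => ip_norm (mean_ip n) f).
Proof.
apply/cauchy_cvgP; apply: cauchy_exP => e e0.
have e2 : 0 < e / 2 by rewrite divr_gt0.
have [s /(snorm_near_lt e2) fs] := besi_approx f e2.
have [l /cvgC_Re lP] := mean_ip_trig_cvg s.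
have sP : ip_norm (mean_ip n) (besi_trig s) @[n --> \oo] --> Num.sqrt (complex.Re l).
  exact: (continuous_cvg _ (@sqrt_continuous R _) lP).
exists (Num.sqrt (complex.Re l)); rewrite /nbhs/=.
have /cvgrPdist_lt /(_ _ e2) := sP.
apply: filterS2 fs => n fs ls; rewrite /ball/= (splitr e).
have := snorm_dist (mean_ip_semi_inner A n) f (besi_trig s); move: fs ls.
set a := Num.sqrt _; set b := ip_norm _ f; set c := ip_norm _ (besi_trig s).
set d := ip_norm _ _.
move=> de ac bc; have -> : a - b = (a - c) - (b - c) by ring.
by rewrite (le_lt_trans (ler_normB _ _))// ltr_leD// (le_trans bc).
Qed.

Definition lim_snorm (f : besi A) : R := limn (fun n => ip_norm (mean_ip n) f).

Lemma lim_snorm_cvg (f : besi A) :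
  ip_norm (mean_ip n) f @[n --> \oo] --> lim_snorm f.
Proof. exact: mean_snorm_is_cvg. Qed.

Lemma lim_snorm_ge0 (f : besi A) : 0 <= lim_snorm f.
Proof.
by apply: limr_ge; [exact: mean_snorm_is_cvg|apply: nearW => n; exact: snorm_ge0].
Qed.

Lemma besi_norm_lim (f : besi A) : besi_norm A f = (lim_snorm f)%:E.
Proof.
apply/eqP; rewrite eq_le; apply/andP; split.
  apply/lee_addgt0Pr => e e0; rewrite -EFinD; apply: besi_norm_le.
    by rewrite addr_ge0 ?lim_snorm_ge0// ltW.
  have /cvgrPdist_lt /(_ _ e0) := @lim_snorm_cvg f.
  apply: filterS => n; rewrite ltr_norml => /andP[H _].
  rewrite mean_sqrE lee_fin ler_sqr ?nnegrE ?snorm_ge0 ?addr_ge0 ?lim_snorm_ge0 ?(ltW e0)//.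
  by move: H; lra.
rewrite leNgt; apply/negP => Hlt.
have b0 := besi_norm_ge0 A f.
have bfin : besi_norm A f \is a fin_num.
  by rewrite ge0_fin_numE// (lt_trans Hlt)// ltry.
move: Hlt b0; rewrite -(fineK bfin) lte_fin lee_fin => Hlt b0.
(* If the upper limit were smaller than the limit, their midpoint would eventually bound the
   seminorms, and so bound the limit too. *)
have r0 : 0 < (fine (besi_norm A f) + lim_snorm f) / 2 by lra.
have : (besi_norm A f < ((fine (besi_norm A f) + lim_snorm f) / 2)%:E)%E.
  by rewrite -[ltLHS](fineK bfin) lte_fin; lra.
move=> /(snorm_near_lt r0) H.
have : lim_snorm f <= _ := limr_le (@mean_snorm_is_cvg f) H.
rewrite ler_pdivlMr// mulr_natr mulr2n lerD2r leNgt.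
by move=> /(_ _)/negP; apply.
Qed.

Lemma lim_snorm_sqr_cvg (f : besi A) :
  complex.Re (mean_ip n f f) @[n --> \oo] --> lim_snorm f ^+ 2.
Proof.
have -> : (fun n => complex.Re (mean_ip n f f)) = (fun n => ip_norm (mean_ip n) f ^+ 2).
  by apply/funext => n; rewrite (snorm_sqr (mean_ip_semi_inner A n)).
by rewrite expr2; apply: cvgM; exact: lim_snorm_cvg.
Qed.

Lemma Re_mean_ip_is_cvg (f g : besi A) : cvgn (fun n => complex.Re (mean_ip n f g)).
Proof.
(* Polarization reduces convergence of the real part to that of squared seminorms. *)
have -> : (fun n => complex.Re (mean_ip n f g)) = (fun n =>
    (complex.Re (mean_ip n (f + g) (f + g)) - complex.Re (mean_ip n f f)
      - complex.Re (mean_ip n g g)) / 2).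
  apply/funext => n; have nP := mean_ip_semi_inner A n.
  by rewrite -!(snorm_sqr nP) (snorm_sqrD nP); lra.
apply: is_cvgM; last exact: is_cvg_cst.
by apply: is_cvgB; [apply: is_cvgB|]; apply: cvgP; exact: lim_snorm_sqr_cvg.
Qed.

Definition limit_ip (f g : besi A) : R[i] :=
  lim ((fun n => mean_ip n f g : R[i]^o) @ \oo).

Lemma limit_ip_cvg (f g : besi A) : cvgC (fun n => mean_ip n f g) (limit_ip f g).
Proof.
apply: cvgP; apply: (@cvgC_ReIm _ _ (Complex _ _)); first exact: Re_mean_ip_is_cvg.
(* The form is conjugate-linear on the right, so replacing [g] by i times [g] multiplies the value
   by -i and moves the imaginary part to the real one. *)
have -> : (fun n => complex.Im (mean_ip n f g)) =
    (fun n => complex.Re (mean_ip n f (Complex 0 1 *: g))).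
  apply/funext => n; rewrite (semi_innerZr (mean_ip_semi_inner A n)).
  by rewrite mulCE conjCE /=; ring.
exact: Re_mean_ip_is_cvg.
Qed.

Lemma limit_ip_eq (f g : besi A) (l : R[i]) :
  cvgC (fun n => mean_ip n f g) l -> limit_ip f g = l.
Proof. exact/cvgC_unique/limit_ip_cvg. Qed.

Lemma limit_ip_semi_inner : semi_inner limit_ip.
Proof.
split=> [a u v w|u v|u].
- apply: limit_ip_eq; under [X in cvgC X]funext do
    rewrite (semi_innerDl (mean_ip_semi_inner A _)) (semi_innerZl (mean_ip_semi_inner A _)).
  apply: cvgCD; last exact: limit_ip_cvg.
  by apply: cvgCM; [exact: cvgC_cst|exact: limit_ip_cvg].
- apply: limit_ip_eq; under [X in cvgC X]funext do rewrite (semi_inner_conj (mean_ip_semi_inner A _)).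
  by apply: cvgC_conj; exact: limit_ip_cvg.
- suff -> : limit_ip u u = (lim_snorm u ^+ 2)%:C%C by rewrite lecR sqr_ge0.
  apply: limit_ip_eq; apply: cvgC_ReIm; first exact: lim_snorm_sqr_cvg.
  by under eq_cvg do rewrite (semi_inner_Re (mean_ip_semi_inner A _)) /=; exact: cvg_cst.
Qed.

Lemma limit_snorm (f : besi A) : ip_norm limit_ip f = lim_snorm f.
Proof.
rewrite /ip_norm -[RHS]ger0_norm ?lim_snorm_ge0// -sqrtr_sqr; congr Num.sqrt.
have := cvgC_Re (@limit_ip_cvg f f) => H.
exact: (cvg_unique (@Rhausdorff R) H (@lim_snorm_sqr_cvg f)).
Qed.

Lemma besi_normE (f : besi A) : besi_norm A f = (ip_norm limit_ip f)%:E.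
Proof. by rewrite limit_snorm besi_norm_lim. Qed.

Lemma besi_ip_repr (x y : besi_quot A) : besi_ip x y = limit_ip (repr x) (repr y).
Proof. by []. Qed.

(** By Cauchy-Schwarz a function of seminorm 0 is orthogonal to everything, so the value does not
    depend on the representatives. *)
Lemma limit_ip_class (f f' g g' : besi A) :
  besi_class f = besi_class f' -> besi_class g = besi_class g' ->
  limit_ip f g = limit_ip f' g'.
Proof.
have P := limit_ip_semi_inner.
have null (u v : besi A) : besi_norm A u = 0%E -> limit_ip u v = 0.
  rewrite besi_normE => -[u0]; apply/eqP; rewrite -cabs_sqr_eq0 sqrf_eq0.
  rewrite eq_le cabs_ge0 andbT.
  by have := semi_inner_CauchySchwarz P u v; rewrite u0 mul0r.
move=> /besi_class_eq ff /besi_class_eq gg.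
rewrite -{1}(subrK f' f) (semi_innerDl P) (null (f - f') g ff) add0r.
rewrite -{1}(subrK g' g) (semi_innerDr P (g - g') g' f').
by rewrite (semi_inner_conj P (g - g') f') (null (g - g') f' gg) rmorph0 add0r.
Qed.

Lemma besi_ip_class (f g : besi A) :
  besi_ip (besi_class f) (besi_class g) = limit_ip f g.
Proof. by rewrite besi_ip_repr; apply: limit_ip_class; rewrite besi_class_repr. Qed.

Lemma besi_ip_semi_inner : semi_inner (@besi_ip R G mu A).
Proof.
have P := limit_ip_semi_inner.
split=> [a x y z|x y|x].
- rewrite -(besi_class_repr x) -(besi_class_repr y) -(besi_class_repr z).
  rewrite -[a *: _]besi_classZ -besi_classD !besi_ip_class.
  by rewrite (semi_innerDl P) (semi_innerZl P).
- by rewrite !besi_ip_repr (semi_inner_conj P).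
- by have [_ _] := P; apply.
Qed.

Lemma besi_quot_normE (x : besi_quot A) :
  besi_quot_norm x = (ip_norm (@besi_ip R G mu A) x)%:E.
Proof. by rewrite /besi_quot_norm besi_normE. Qed.

Lemma ip_norm_besi_class (f : besi A) :
  ip_norm (@besi_ip R G mu A) (besi_class f) = ip_norm limit_ip f.
Proof. by rewrite /ip_norm besi_ip_class. Qed.

Lemma besi_quot_norm_class (f : besi A) :
  besi_quot_norm (besi_class f) = besi_norm A f.
Proof. by rewrite besi_quot_normE ip_norm_besi_class besi_normE. Qed.

Lemma besi_class0 : besi_class (0 : besi A) = 0.
Proof. by apply: (addrI (besi_class (0 : besi A))); rewrite -besi_classD !addr0. Qed.

Lemma besi_ip_definite (x : besi_quot A) : x != 0 -> 0 < besi_ip x x.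
Proof.
have P := besi_ip_semi_inner.
rewrite -(besi_class_repr x) => x0; have [_ _ /(_ (besi_class (repr x)))] := P.
rewrite le_eqVlt => /predU1P[|//] H; move/eqP: x0; case.
rewrite -besi_class0; apply/besi_class_eq.
rewrite -[LHS](besi_quot_norm_class (repr x - 0)) subr0 besi_quot_normE.
by rewrite /ip_norm -H /= sqrtr0.
Qed.

Lemma besi_ip_inner_product : inner_product (@besi_ip R G mu A).
Proof.
have P := besi_ip_semi_inner; have D := besi_ip_definite.
pose B := isBilinear.Build R[i] (besi_quot A) (besi_quot A) R[i]
  *%R (@Num.conj R[i] \; *%R) (@besi_ip R G mu A)
  (fun w u v => semi_innerBl P u v w)
  (fun w u v => semi_innerBr P u v w)
  (fun w a u => semi_innerZl P a u w)
  (fun w a u => semi_innerZr P a u w).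
(* The parameter [false] selects the hermitian rather than the skew-hermitian case; [mul1r] absorbs
   the resulting sign 1. *)
pose H := isHermitianSesquilinear.Build R[i] (besi_quot A) false (@Num.conj R[i])
  (@besi_ip R G mu A) (fun x y => etrans (semi_inner_conj P y x) (esym (mul1r _))).
pose Dt := isDotProduct.Build R[i] (besi_quot A) (@besi_ip R G mu A) D.
pose form : {dot (besi_quot A) for @Num.conj R[i]} :=
  HB.pack (@besi_ip R G mu A) B H Dt.
by exists form.
Qed.

End limit_form.

(** * Exhaustions and volumes *)

(** A covering by compact sets need not absorb every compact set. Adding a compact neighbourhood [U]
    of 0 to each [K i] yields compact sets that contain a neighbourhood of every point of [K i];
    their finite unions absorb all compact sets. *)
Lemma lca_compact_exhaustion (G : lcaGroupType) : exists L : nat -> set G,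
  (forall n, compact (L n)) /\
  (forall K : set G, compact K -> exists n, K `<=` L n).
Proof.
have [K [cK KT]] := @lca_sigma_compact G.
have [U U0 [cU _]] : compact_near (nbhs (0 : G)).
  by have := @lca_locally_compact G (0 : G) I; rewrite /= withinET.
pose S i := (fun z : G * G => z.1 + z.2) @` (K i `*` U).
have cS i : compact (S i).
  apply: continuous_compact; last exact: compact_setX.
  by apply: continuous_subspaceT => z; exact: add_continuous.
exists (fun n => \big[setU/set0]_(i < n.+1) S i); split.
  by move=> n; exact: bigsetU_compact.
move=> C; rewrite compact_near_coveringP => cC.
have [|N _ /(_ N (leqnn N)) CN] := cC nat \oo
  (fun n x => (\big[setU/set0]_(i < n.+1) S i) x) _ _; last by exists N.
move=> x Cx; have [i _ Kix] : (\bigcup_n K n) x by rewrite KT.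
have Ux : \forall x' \near x, U (x' - x).
  have cx : (fun y : G => y - x) @ x --> (0 : G).
    by rewrite -(subrr x); exact: continuousD_cst.
  exact: cx.
exists ([set x' | U (x' - x)], [set n | (i <= n)%N]).
  by split => //=; exists i.
move=> [x' n] [/= Ux' ni]; rewrite -bigcup_mkord; exists i => //=.
by exists (x, x' - x) => //=; rewrite addrC subrK.
Qed.

(** * Lower bounds for the volumes of van Hove sets *)

Section van_hove_volume.
Context (R : realType) (G : lcaGroupType) (mu : haar_measure R G).
Context (A : van_hove_sequence mu).

(* A translate of [K] by a point of [A n] lies in [A n] up to the van Hove
   boundary of [A n]. *)
Lemma vh_compact_le (K : set G) n : compact K ->
  (mu K <= mu (A n) + mu (vh_boundary K (A n)))%E.
Proof.
move=> cK.
have mA := vh_measurable A n; have mK := borel_compact cK.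
have mB : measurable (vh_boundary K (A n) : set (borel G)).
  by apply: borel_closed; exact: vh_boundary_closed.
have [a Aa] : exists a, A n a.
  apply/set0P/eqP => A0; have := vh_gt0 A n.
  by rewrite A0 measure0 ltxx.
rewrite -(haar_translation mu a mK).
apply: (@le_trans _ _ (mu ((A n : set (borel G)) `|` vh_boundary K (A n)))); last first.
  exact: measureU2.
apply: le_measure; rewrite ?inE.
- rewrite image_addr -[X in measurable X]setTI.
  exact: (measurable_fun_translate (- a) measurableT mK).
- exact: measurableU.
- move=> _ [k Kk <-]; have [Aak|Aak] := pselect (A n (a + k)); [by left|right].
  left; split; apply: subset_closure => //.
  by exists a => //; exists k.
Qed.

(** Inner regularity gives a compact [K] of measure above [r], and [vh_compact_le] bounds that
    measure by the volume of [A n] plus a boundary term of smaller order. *)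
Lemma vh_volume_gt (r : R) : (r%:E < mu setT)%E ->
  \forall n \near \oo, r < fine (mu (A n)).
Proof.
have [r0 _|r0 rT] := leP r 0.
  by apply: nearW => n; apply: le_lt_trans r0 _; exact: vh_fine_gt0.
have [K cK rK] : exists2 K : set G, compact K & (r%:E < mu K)%E.
  move: rT; rewrite (haar_inner mu (@openT G)) => /ereal_sup_gt[_ [K [cK _] <-] rK].
  by exists K.
have kfin : mu K \is a fin_num by rewrite ge0_fin_numE//; exact: haar_compact.
rewrite -(fineK kfin) lte_fin in rK.
set k := fine (mu K) in rK.
(* With a boundary ratio below [(k - r) / r], a volume of [A n] at most [r] would bound [k] by
   something less than [r + (k - r)]. *)
have d0 : 0 < (k - r) / r by rewrite divr_gt0// subr_gt0.
have [Bfin /cvgrPdist_lt/(_ _ d0) Bd] := (fine_cvgP _ _).1 (vh_cvg A cK).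
near=> n; rewrite ltNge; apply/negP => cr.
have c0 := vh_fine_gt0 A n.
have : `|0 - fine (mu (vh_boundary K (A n)) * (fine (mu (A n)))^-1%:E)%E| < (k - r) / r.
  by near: n.
have : (mu (vh_boundary K (A n)) * (fine (mu (A n)))^-1%:E)%E \is a fin_num by near: n.
have := vh_compact_le n cK; rewrite -(fineK kfin) -/k.
have : (0 <= mu (vh_boundary K (A n)))%E by [].
case: (mu (vh_boundary K (A n))) => [b| |//].
- rewrite -[X in (_ <= X + _)%E](fineK (vh_fin_num A n)) -EFinD !lee_fin/= => b0 kcb _.
  rewrite sub0r normrN ger0_norm ?mulr_ge0 ?invr_ge0 ?(ltW c0)//.
  rewrite ltr_pdivrMr// mulrAC ltr_pdivlMr// => H.
  have : (b * r < b * r)%R; last by rewrite ltxx.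
  nra.
- by rewrite gt0_mulye// lte_fin invr_gt0.
Unshelve. all: end_near. Qed.

End van_hove_volume.

(** * Pointwise telescoping inequality and geometric sums *)

Section telescoping.
Context (R : realType).

Lemma cabs_sqrD (z w : R[i]) : cabs (z + w) ^+ 2 <= 2 * cabs z ^+ 2 + 2 * cabs w ^+ 2.
Proof.
rewrite !cabs_sqr; case: z w => a b [c d] /=; rewrite -subr_ge0.
rewrite (_ : _ - _ = (a - c) ^+ 2 + (b - d) ^+ 2); last by ring.
by rewrite addr_ge0 ?sqr_ge0.
Qed.

(** Induction peeling off the first increment with [cabs_sqrD]. The factor 2 lost on the remainder
    turns the prefactor for [l.+1] into the one for [l], and the weight [2 ^+ l] gives the peeled
    increment its coefficient 2. *)
Lemma telescope_sqr (z : nat -> R[i]) l m : (l <= m)%N ->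
  cabs (z m - z l) ^+ 2 <= 2 * 2^-1 ^+ l *
    \sum_(l <= i < m) 2 ^+ i * cabs (z i.+1 - z i) ^+ 2.
Proof.
move=> lm; rewrite -(subnKC lm); move: (m - l)%N => k {lm m}.
elim: k l => [|k IH] l.
  by rewrite addn0 subrr cabs_sqr /= expr0n/= addr0 big_geq// mulr0.
rewrite -addSnnS big_ltn; last by rewrite addSn ltnS leq_addr.
have -> : z (l.+1 + k)%N - z l = (z (l.+1 + k)%N - z l.+1) + (z l.+1 - z l).
  by rewrite addrA subrK.
apply: le_trans (cabs_sqrD _ _) _.
rewrite mulrDr [leRHS]addrC lerD//.
  apply: le_trans (ler_wpM2l _ (IH l.+1)) _ => //.
  by rewrite exprS; set X := \sum_(_ <= _ < _) _; rewrite !mulrA mulfK// mulrAC.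
set X := cabs _ ^+ 2; rewrite (_ : 2 * 2^-1 ^+ l * _ = 2 * X)//.
by rewrite mulrA -(mulrA 2) -exprMn mulVf// expr1n mulr1.
Qed.

Lemma geometric_tail l m :
  \sum_(l <= i < m) (2^-1 ^+ i : R) <= 2 * 2^-1 ^+ l.
Proof.
have [ml|lm] := leqP m l; first by rewrite big_geq// mulr_ge0.
rewrite -(subnKC (ltnW lm)); move: (m - l)%N => k {lm m}.
elim: k l => [|k IH] l; first by rewrite addn0 big_geq// mulr_ge0.
rewrite -addSnnS big_ltn; last by rewrite addSn ltnS leq_addr.
apply: le_trans (lerD (lexx _) (IH l.+1)) _.
by rewrite exprS mulrA divff// mul1r -mulr2n mulr_natl.
Qed.

End telescoping.

(** * Completeness *)

Section completion.
Context (R : realType) (G : lcaGroupType) (mu : haar_measure R G).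
Context (A : van_hove_sequence mu) (p : nat -> besi A).
Hypothesis p_bounded : forall k, exists C : R, forall t, cabs (p k t) <= C.
Hypothesis p_cauchy : forall k,
  (besi_norm A (p k.+1 - p k)%R < (2^-1 ^+ k)%:E)%E.

Let g i (t : G) : R := cabs (p i.+1 t - p i t) ^+ 2.

Let g_ge0 i t : 0 <= g i t. Proof. exact: sqr_ge0. Qed.

Let g_measurable i (D : set (borel G)) : measurable_fun D (fun t => (g i t)%:E).
Proof. exact: (measurable_cabs_sqr (besi_L2loc (p i.+1 - p i))). Qed.

Lemma increment_integral i : exists M, forall n, (M <= n)%N ->
  (\int[mu]_(t in (A n : set (borel G))) (g i t)%:E <=
    (fine (mu (A n)) * (2^-1 ^+ i) ^+ 2)%:E)%E.
Proof.
have e0 : 0 < 2^-1 ^+ i :> R by rewrite exprn_gt0.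
have [M _ MP] := besi_norm_lt e0 (p_cauchy i).
exists M => n /MP /=; rewrite /mean_sqr muleC lee_pdivrMr ?vh_fine_gt0//.
by rewrite -EFinM mulrC.
Qed.

Lemma besi_of_approx (f : G -> R[i]) : L2loc mu f ->
  (forall l, (besi_norm A (f - p l)%R <= (3 * 2^-1 ^+ l)%:E)%E) ->
  besicovitch A f.
Proof.
move=> lf fp; split => // e e0.
(* For [a = 1], [besi_norm_lincomb] costs a factor 4, so the total is [e / 2]. *)
have d0 : 0 < e / 8 by rewrite divr_gt0.
have [l le] : exists l, 3 * 2^-1 ^+ l < e / 8 :> R.
  have /cvgrPdist_lt /(_ _ (divr_gt0 d0 (ltr0n _ 3))) [l _ /(_ l (leqnn l))] :
      (GRing.exp (2^-1 : R)) @ \oo --> (0 : R).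
    by apply: cvg_expr; rewrite ger0_norm// invf_lt1// ltr1n.
  rewrite /= sub0r normrN ger0_norm ?exprn_ge0// ltr_pdivlMr// mulrC.
  by exists l.
have [s sP] := besi_approx (p l) d0.
exists (besi_trig A s); split; first by exists s; exact: besi_trigE.
have -> : f - besi_trig A s = 1 *: (f - p l) + (p l - besi_trig A s).
  by rewrite scale1r addrA subrK.
have lfp : L2loc mu (f - p l).
  by rewrite addrC -scaleN1r; apply: L2loc_lincomb => //; exact: besi_L2loc.
have fpl : (besi_norm A (f - p l)%R < (e / 8)%:E)%E.
  by apply: le_lt_trans (fp l) _; rewrite lte_fin.
apply: le_lt_trans (besi_norm_lincomb 1 lfp (besi_L2loc (p l - besi_trig A s)) d0 fpl sP) _.
rewrite lte_fin (_ : cabs 1 = 1); last by rewrite /cabs normr1.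
by lra.
Qed.

(** The constant 9 is a square above both the 5 reached in infinite volume and the 8 reached in
    finite volume. *)
Lemma mean_sqr_besi_norm (f : G -> R[i]) l :
  (\forall n \near \oo, (mean_sqr A (f - p l)%R n <= (9 * (2^-1 ^+ l) ^+ 2)%:E)%E) ->
  (besi_norm A (f - p l)%R <= (3 * 2^-1 ^+ l)%:E)%E.
Proof.
move=> H; apply: besi_norm_le; first by rewrite mulr_ge0.
apply: filterS H => n; rewrite exprMn.
by rewrite (_ : 3 ^+ 2 = 9) // -natrX.
Qed.

Lemma vh_exhaustion (N : nat -> nat) : exists D : nat -> set G,
  [/\ forall k, compact (D k),
      forall k n, (n < N k)%N -> A n `<=` D k &
      forall K : set G, compact K -> exists k, K `<=` D k].
Proof.
have [L [cL KL]] := lca_compact_exhaustion G.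
exists (fun k => \big[setU/set0]_(n < N k) closure (A n) `|` L k); split=> [k|k n nk|K cK].
- apply: compactU => //; apply: bigsetU_compact => n _.
  by rewrite -precompactE; exact: vh_precompact.
- move=> x Ax; left; rewrite -(bigcup_mkord (N k) (fun n => closure (A n))); exists n => //.
  exact: subset_closure.
- by have [k Kk] := KL K cK; exists k => x /Kk; right.
Qed.

(** * Completeness in infinite volume *)

Section infinite_volume.
Hypothesis mu_oo : (mu [set: borel G] = +oo)%E.

Lemma completion_infinite : exists f : G -> R[i], L2loc mu f /\
  forall l, (besi_norm A (f - p l)%R <= (3 * 2^-1 ^+ l)%:E)%E.
Proof.
have [M MP] := choice increment_integral.
have [C CP] := choice p_bounded.
have C0 k : 0 <= C k by apply: le_trans (CP k 0); exact: cabs_ge0.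
(* [D k] contains every [A n] with [n < M k], where the estimate of increment [k] may fail, and
   every [A n] with [n <= k], which keeps [kappa] at most [n] on [A n]. *)
have [D [cD AD KD]] := vh_exhaustion (fun k => maxn (M k) k.+1).
have mD k := borel_compact (cD k).
have Dx x : exists k, `[< D k x >].
  have [k kx] := KD [set x] (@compact_set1 _ x).
  by exists k; apply/asboolP; exact: kx.
pose kappa x := ex_minn (Dx x).
have kappa_in x : D (kappa x) x by rewrite /kappa; case: ex_minnP => m /asboolP.
have kappa_min x k : D k x -> (kappa x <= k)%N.
  by rewrite /kappa; case: ex_minnP => m _ H Dk; apply: H; exact/asboolP.
(* If [n] were below [maxn (M i) i.+1], then [A n] would lie in [D i] and [kappa x] would be at most
   [i]. So each increment used at a point of [A n] has its integral over [A n] under control. *)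
have kappa_vh x n i : A n x -> (i < kappa x)%N -> (M i <= n)%N /\ (i < n)%N.
  move=> Ax ik; have [ni|] := ltnP n (maxn (M i) i.+1).
    by have := kappa_min x i (AD _ _ ni _ Ax); rewrite leqNgt ik.
  by rewrite geq_max => /andP[].
pose f x := p (kappa x) x.
have mkappa k : measurable ([set x | kappa x = k] : set (borel G)).
  rewrite (_ : [set x | kappa x = k] = D k `\` \bigcup_(j < k) D j).
    apply: measurableD; first exact: mD.
    by apply: bigcup_measurable => j _; exact: mD.
  apply/seteqP; split=> [x /= <-|x [Dkx nDx]].
    split=> // -[j /= jk Djx].
    by have := kappa_min x j Djx; rewrite leqNgt jk.
  apply/eqP; rewrite eqn_leq kappa_min//= leqNgt; apply/negP => kk.
  by apply: nDx; exists (kappa x).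
have mglue (h : nat -> G -> R) :
    (forall k, measurable_fun [set: borel G] (h k : borel G -> R)) ->
    measurable_fun [set: borel G] (fun x : G => h (kappa x) x).
  move=> mh _ B mB; rewrite setTI.
  rewrite (_ : _ @^-1` B = \bigcup_k ([set x | kappa x = k] `&` h k @^-1` B)).
    apply: bigcup_measurable => k _; apply: measurableI; first exact: mkappa.
    by rewrite -[X in measurable X]setTI; exact: mh.
  apply/seteqP; split=> [x /= Bx|x [k _ [/= <-]]//].
  by exists (kappa x).
(* Only [p 0] to [p k] occur on [D k], so [f] is bounded on every compact set. *)
have fD x k : D k x -> cabs (f x) <= \sum_(j < k.+1) C j.
  move=> /kappa_min; rewrite -ltnS => kk; apply: le_trans (CP _ _) _.
  by rewrite (bigD1 (Ordinal kk))//= lerDl sumr_ge0.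
have lf : L2loc mu f.
  split.
  - by apply: (mglue (fun k x => complex.Re (p k x))) => k; have [] := besi_L2loc (p k).
  - by apply: (mglue (fun k x => complex.Im (p k x))) => k; have [] := besi_L2loc (p k).
  - move=> K cK; have [k Kk] := KD K cK.
    apply: (@le_lt_trans _ _ (\int[mu]_(t in (K : set (borel G)))
        ((\sum_(j < k.+1) C j) ^+ 2)%:E)%E).
      apply: ge0_le_integral => //.
      + exact: borel_compact.
      + by move=> t _; rewrite lee_fin sqr_ge0.
      + apply/measurable_EFinP; under eq_fun do rewrite cabs_sqr.
        apply: measurable_funD; apply: (measurable_funX 2); apply: measurable_funTS.
          by apply: (mglue (fun k x => complex.Re (p k x))) => j;
            have [] := besi_L2loc (p j).
        by apply: (mglue (fun k x => complex.Im (p k x))) => j;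
            have [] := besi_L2loc (p j).
      + move=> t Kt; rewrite lee_fin ler_sqr ?nnegrE ?cabs_ge0 ?sumr_ge0//.
        exact/fD/Kk.
    rewrite integral_cst; last exact: borel_compact.
    by rewrite lte_mul_pinfty ?lee_fin ?sqr_ge0//; exact: haar_compact.
exists f; split => // l; apply: mean_sqr_besi_norm.
(* [E] is where [kappa] is at most [l]. There the difference is merely bounded by the constant [T],
   which is harmless because [E] has finite measure; elsewhere one telescopes from [l] up to
   [kappa]. *)
pose E : set (borel G) := \big[setU/set0]_(j < l.+1) D j.
have cE : compact (E : set G) by exact: bigsetU_compact.
have mE : measurable E by exact: borel_compact.
have Efin : mu E \is a fin_num by rewrite ge0_fin_numE//; exact: haar_compact.
pose T := \sum_(j < l.+1) C j + C l.
pose c : R := 2 * 2^-1 ^+ l.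
have c0 : 0 <= c by rewrite mulr_ge0.
have cw i : 0 <= c * 2 ^+ i by rewrite mulr_ge0// exprn_ge0.
have cwg i t : 0 <= (c * 2 ^+ i) * g i t by rewrite mulr_ge0// g_ge0.
pose r n := [seq i <- index_iota l n | (M i <= n)%N].
have bound n t : A n t -> cabs (f t - p l t) ^+ 2 <= T ^+ 2 * \1_E t +
    \sum_(i <- r n) (c * 2 ^+ i) * g i t.
  have S0 : 0 <= \sum_(i <- r n) (c * 2 ^+ i) * g i t.
    by apply: sumr_ge0 => i _; exact: cwg.
  move=> At; have [kl|lk] := leqP (kappa t) l.
    have Et : E t by rewrite /E -(bigcup_mkord l.+1 D); exists (kappa t).
    rewrite indicE mem_set// mulr1; apply: (@le_trans _ _ (T ^+ 2)); last by rewrite lerDl.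
    rewrite ler_sqr ?nnegrE ?cabs_ge0 ?addr_ge0 ?sumr_ge0//.
    apply: le_trans (cabsD _ _) _; rewrite cabsN lerD//.
    apply: le_trans (CP _ _) _.
    have kl' : (kappa t < l.+1)%N by [].
    by rewrite (bigD1 (Ordinal kl'))//= lerDl sumr_ge0.
  apply: le_trans (telescope_sqr (fun k => p k t) (ltnW lk)) _.
  (* Apply [kappa_vh] to the predecessor of [kappa t], which is positive since it exceeds [l]. *)
  have kn : (kappa t <= n)%N.
    by have [|_] := @kappa_vh t n (kappa t).-1 At; rewrite prednK//; case: (kappa t) lk.
  rewrite mulr_sumr /r big_filter [X in _ <= _ + X](@big_cat_nat _ _ _ (kappa t))//=;
    last exact: ltnW.
  rewrite -[leLHS]add0r lerD//; first by apply: mulr_ge0; rewrite ?sqr_ge0.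
  rewrite -[leLHS]addr0 lerD//; last by apply: sumr_ge0 => i _; exact: cwg.
  rewrite big_nat_cond [leRHS]big_nat_cond.
  rewrite le_eqVlt; apply/orP; left; apply/eqP; apply: eq_big => [i|i _].
    rewrite andbT; case: (boolP (l <= i < kappa t)%N) => //= /andP[_ ik].
    by have [->] := kappa_vh t n i At ik.
  by rewrite mulrA.
have int_bound n : (\int[mu]_(t in (A n : set (borel G))) (cabs (f t - p l t) ^+ 2)%:E
    <= (T ^+ 2 * fine (mu E) + fine (mu (A n)) * c ^+ 2)%:E)%E.
  have mA := vh_measurable A n.
  have lfp : L2loc mu (f - p l).
    by rewrite addrC -scaleN1r; apply: L2loc_lincomb => //; exact: besi_L2loc.
  apply: (@le_trans _ _ (\int[mu]_(t in (A n : set (borel G)))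
    ((T ^+ 2)%:E * (\1_E t)%:E + \sum_(i <- r n) (c * 2 ^+ i)%:E * (g i t)%:E))%E).
    apply: ge0_le_integral => //.
    - by move=> t _; rewrite lee_fin sqr_ge0.
    - exact: measurable_cabs_sqr lfp.
    - apply: emeasurable_funD.
        by apply: measurable_funeM; apply/measurable_EFinP; exact: measurable_indic.
      by apply: emeasurable_sum => i; exact: measurable_funeM.
    - move=> t At; under eq_bigr do rewrite -EFinM.
      by rewrite sumEFin -EFinM -EFinD lee_fin; exact: bound.
  rewrite ge0_integralD//; last first.
  - by apply: emeasurable_sum => i; exact: measurable_funeM.
  - by move=> t _; apply: sume_ge0 => i _; rewrite -EFinM lee_fin cwg.
  - by apply: measurable_funeM; apply/measurable_EFinP; exact: measurable_indic.
  - by move=> t _; rewrite -EFinM lee_fin mulr_ge0 ?sqr_ge0.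
  rewrite EFinD leeD//.
    rewrite ge0_integralZl_EFin ?sqr_ge0//; last first.
    - by apply/measurable_EFinP; exact: measurable_indic.
    rewrite integral_indic// [leRHS]EFinM lee_wpmul2l ?lee_fin ?sqr_ge0// fineK//.
    apply: le_measure; rewrite ?inE; [exact: measurableI|exact: mE|exact: subIsetl].
  rewrite ge0_integral_sum//; last first.
  - by move=> i t _; rewrite -EFinM lee_fin cwg.
  - by move=> i; exact: measurable_funeM.
  (* The weight [2 ^+ i] uses up one of the two factors [2^-1 ^+ i] in the increment estimate; the
     other leaves a geometric sum. *)
  apply: (@le_trans _ _ (\sum_(i <- r n) (c * fine (mu (A n)) * 2^-1 ^+ i)%:E)%E).
    rewrite big_seq [leRHS]big_seq; apply: lee_sum => i.
    rewrite mem_filter => /andP[Min _].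
    rewrite ge0_integralZl_EFin//; last by move=> t _; rewrite lee_fin g_ge0.
    apply: le_trans (lee_wpmul2l _ (MP i n Min)) _; first by rewrite lee_fin cw.
    rewrite -EFinM lee_fin le_eqVlt; apply/orP; left; apply/eqP.
    have hh : 2 ^+ i * 2^-1 ^+ i = 1 :> R by rewrite -exprMn divff// expr1n.
    move: hh; set a := 2 ^+ i; set b := 2^-1 ^+ i; set m := fine _ => hh.
    by transitivity (c * m * b * (a * b)); [ring|rewrite hh mulr1].
  rewrite sumEFin lee_fin -mulr_sumr [c * fine _]mulrC -mulrA.
  rewrite ler_wpM2l ?fine_ge0// [leRHS]expr2 ler_wpM2l// /r big_filter.
  apply: le_trans (geometric_tail R l n).
  by rewrite big_mkcond/=; apply: ler_sum => i _; case: ifP => // _; rewrite exprn_ge0.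
have l0 : 0 < (2^-1 ^+ l) ^+ 2 :> R by rewrite !exprn_gt0.
(* Past this threshold the contribution of [E] is at most [(2^-1 ^+ l) ^+ 2] times the volume of
   [A n]; with [c ^+ 2] this gives the constant 5. *)
have := @vh_volume_gt R G mu A (T ^+ 2 * fine (mu E) / (2^-1 ^+ l) ^+ 2).
rewrite mu_oo ltry => /(_ erefl); apply: filterS => n.
rewrite ltr_pdivrMr// => Hn.
rewrite /mean_sqr muleC lee_pdivrMr ?vh_fine_gt0//.
apply: le_trans (int_bound n) _; rewrite -EFinM lee_fin.
have := vh_fine_gt0 A n; move: Hn l0; rewrite /c exprMn.
set q := (2^-1 ^+ l) ^+ 2; set m := fine (mu (A n)); set e := T ^+ 2 * _.
nra.
Qed.

End infinite_volume.

(** * Completeness in finite volume *)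

Section finite_volume.
Hypothesis mu_fin : (mu [set: borel G] < +oo)%E.

Let mG : R := fine (mu [set: borel G]).

Let mG_ge0 : 0 <= mG. Proof. exact: fine_ge0. Qed.

Let mGE : mu [set: borel G] = mG%:E.
Proof. by rewrite /mG fineK// ge0_fin_numE. Qed.

(** The volume of [A n] approaches that of the whole group, and [g i] is bounded, so the integral
    outside [A n] is at most any prescribed [e]. *)
Lemma increment_integralT i :
  (\int[mu]_(t in [set: borel G]) (g i t)%:E <= (mG * (2^-1 ^+ i) ^+ 2)%:E)%E.
Proof.
have [M MP] := increment_integral i.
have [C1 C1P] := p_bounded i.+1; have [C2 C2P] := p_bounded i.
pose B := (C1 + C2) ^+ 2.
have gB t : g i t <= B.
  have C10 : 0 <= C1 by apply: le_trans (C1P 0); exact: cabs_ge0.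
  have C20 : 0 <= C2 by apply: le_trans (C2P 0); exact: cabs_ge0.
  rewrite ler_sqr ?nnegrE ?cabs_ge0 ?addr_ge0//.
  by apply: le_trans (cabsD _ _) _; rewrite cabsN lerD.
have B0 : 0 <= B by exact: sqr_ge0.
apply/lee_addgt0Pr => e e0.
(* Dividing by [B + 1] also covers [B = 0]. *)
have e1 : 0 < e / (B + 1) by rewrite divr_gt0// ltr_wpDl.
have /(vh_volume_gt A) [N _ NP] : ((mG - e / (B + 1))%:E < mu [set: borel G])%E.
  by rewrite mGE lte_fin gtrBl.
pose n := maxn M N.
have mA := vh_measurable A n; have mAC := measurableC mA.
have H : mG = fine (mu (A n)) + fine (mu (~` (A n : set (borel G)))).
  have : mu [set: borel G] = (mu (A n) + mu (~` (A n : set (borel G))))%E.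
    by rewrite -measureU ?setICr// setUv.
  rewrite /mG => ->; rewrite fineD// ?vh_fin_num// ge0_fin_numE//.
  by apply: le_lt_trans mu_fin; apply: le_measure; rewrite ?inE.
rewrite -(setUv (A n : set (borel G))) ge0_integral_setU//; last by apply/disj_setPS; rewrite setICr.
have := NP n (leq_maxr _ _); rewrite /= => Hn.
apply: (@le_trans _ _ ((fine (mu (A n)) * (2^-1 ^+ i) ^+ 2)%:E +
    (B * fine (mu (~` (A n : set (borel G)))))%:E)%E).
  apply: leeD; first exact/MP/leq_maxl.
  apply: (@le_trans _ _ (\int[mu]_(t in ~` (A n : set (borel G))) B%:E)%E).
    by apply: ge0_le_integral => // t _; rewrite lee_fin.
  rewrite integral_cst// [leRHS]EFinM fineK// ge0_fin_numE//.
  by apply: le_lt_trans mu_fin; apply: le_measure; rewrite ?inE.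
rewrite -!EFinD lee_fin; move: Hn; rewrite H.
have := fine_ge0 (measure_ge0 mu (~` (A n : set (borel G)))).
set m := fine (mu (A n)); set m' := fine _; set q := (2^-1 ^+ i) ^+ 2 => m'0 Hm.
have q0 : 0 <= q by exact: sqr_ge0.
have Bm : B * m' <= e.
  have : m' <= e / (B + 1) by lra.
  rewrite ler_pdivlMr ?ltr_wpDl//; nra.
by rewrite mulrDl -addrA lerD2l; nra.
by move=> t _; rewrite lee_fin g_ge0.
Qed.

Let shift_sum (F : nat -> R) l k :
  \sum_(l <= i < l + k) F i = \sum_(0 <= j < k) F (j + l)%N.
Proof. by rewrite -{1}[l]add0n big_addn addKn. Qed.

Let c l : R := 2 * 2^-1 ^+ l.
Let c_ge0 l : 0 <= c l. Proof. by rewrite /c mulr_ge0. Qed.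

(** The weighted terms of [telescope_sqr], reindexed to start at [l]; extended real values allow the
    series to diverge at some points. *)
Let tail l j (t : G) : \bar R := (2 ^+ (j + l))%:E * (g (j + l) t)%:E.

Let tail_ge0 l j t : (0 <= tail l j t)%E.
Proof. by rewrite /tail -EFinM lee_fin mulr_ge0 ?g_ge0// exprn_ge0. Qed.

Lemma tail_integral l :
  (\int[mu]_(t in [set: borel G]) (\sum_(j <oo) tail l j t) <= (mG * c l)%:E)%E.
Proof.
rewrite integral_nneseries//; last first.
  by move=> j; exact: measurable_funeM.
apply: lime_le.
  by apply: is_cvg_nneseries => j _ _; apply: integral_ge0.
apply: nearW => k /=.
apply: (@le_trans _ _ (\sum_(0 <= j < k) (mG * 2^-1 ^+ (j + l))%:E)%E).
  apply: lee_sum => j _.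
  rewrite ge0_integralZl_EFin ?exprn_ge0//; last by move=> t _; rewrite lee_fin g_ge0.
  apply: le_trans (lee_wpmul2l _ (increment_integralT (j + l))) _.
    by rewrite lee_fin exprn_ge0.
  have hh : 2 ^+ (j + l) * 2^-1 ^+ (j + l) = 1 :> R by rewrite -exprMn divff// expr1n.
  rewrite -EFinM lee_fin le_eqVlt; apply/orP; left; apply/eqP.
  move: hh; set a := 2 ^+ _; set b := 2^-1 ^+ _ => hh.
  by transitivity (mG * b * (a * b)); [ring|rewrite hh mulr1].
rewrite sumEFin lee_fin -mulr_sumr ler_wpM2l// -(shift_sum (fun i => 2^-1 ^+ i)).
exact: geometric_tail.
Qed.

Lemma completion_finite : exists f : G -> R[i], L2loc mu f /\
  forall l, (besi_norm A (f - p l)%R <= (3 * 2^-1 ^+ l)%:E)%E.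
Proof.
(* Upper limits are measurable and defined everywhere. Where one is infinite [fine] returns 0; the
   bound below is trivial at such points. *)
pose fR (t : G) := fine (limn_esup (fun k => (complex.Re (p k t))%:E)).
pose fI (t : G) := fine (limn_esup (fun k => (complex.Im (p k t))%:E)).
pose f t := Complex (fR t) (fI t).
have mfR : measurable_fun [set: borel G] fR.
  apply: measurableT_comp => //; apply: measurable_fun_limn_esup => k.
  by apply/measurable_EFinP; have [] := besi_L2loc (p k).
have mfI : measurable_fun [set: borel G] fI.
  apply: measurableT_comp => //; apply: measurable_fun_limn_esup => k.
  by apply/measurable_EFinP; have [] := besi_L2loc (p k).
have bound l t : ((cabs (f t - p l t) ^+ 2)%:E <= (c l)%:E * \sum_(j <oo) tail l j t)%E.
  have S0 : (0 <= \sum_(j <oo) tail l j t)%E by apply: nneseries_ge0.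
  have part k : (\sum_(0 <= j < k) tail l j t <= \sum_(j <oo) tail l j t)%E.
    exact: nneseries_lim_ge.
  (* Where the series diverges the right side is infinite, so the inequality holds at every point
     and no exceptional null set is removed. *)
  case: (\sum_(j <oo) tail l j t)%E S0 part => [S| _ _|//]; last first.
    by rewrite gt0_muley ?leey// lte_fin mulr_gt0// exprn_gt0.
  rewrite lee_fin -EFinM lee_fin => S0 part.
  have dist m l' : (l <= l')%N -> (l' <= m)%N -> cabs (p m t - p l' t) ^+ 2 <= c l' * S.
    move=> ll' lm; apply: le_trans (telescope_sqr (fun k => p k t) lm) _.
    rewrite ler_wpM2l//.
    rewrite -lee_fin; apply: le_trans (part (m - l)%N).
    under [leRHS]eq_bigr do rewrite /tail -EFinM.
    rewrite sumEFin lee_fin -(shift_sum (fun i => 2 ^+ i * g i t)).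
    rewrite subnKC ?(leq_trans ll')// [leRHS](@big_cat_nat _ _ _ l')//=.
    by rewrite lerDr sumr_ge0// => i _; rewrite mulr_ge0 ?g_ge0// exprn_ge0.
  (* Stated for any 1-Lipschitz [h], to serve for both the real and the imaginary part. *)
  have cauchy (h : R[i] -> R) : (forall z w, `|h z - h w| <= cabs (z - w)) ->
      cvgn (fun k => h (p k t)).
    move=> hc; apply/cauchy_cvgP; apply: cauchy_exP => e e0.
    have [l1 l1P] : exists l1, 2^-1 ^+ l1 * (2 * S) < e ^+ 2.
      have e2 : 0 < e ^+ 2 / (2 * S + 1).
        by rewrite divr_gt0 ?exprn_gt0// ltr_wpDl// mulr_ge0.
      have /cvgrPdist_lt /(_ _ e2) [l1 _ /(_ l1 (leqnn l1))] :
          (GRing.exp (2^-1 : R)) @ \oo --> (0 : R).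
        by apply: cvg_expr; rewrite ger0_norm// invf_lt1// ltr1n.
      rewrite /= sub0r normrN ger0_norm ?exprn_ge0//.
      rewrite ltr_pdivlMr; last by rewrite ltr_wpDl// mulr_ge0.
      move=> H; exists l1; apply: le_lt_trans H.
      by rewrite ler_wpM2l ?exprn_ge0// lerDl.
    pose l' := maxn l l1; exists (h (p l' t)).
    exists l' => // m /= l'm; rewrite /ball/=.
    apply: le_lt_trans (hc _ _) _; rewrite -cabsN opprB.
    rewrite -ltr_sqr ?nnegrE ?cabs_ge0 ?(ltW e0)//.
    apply: le_lt_trans (dist m l' (leq_maxl _ _) l'm) _; apply: le_lt_trans l1P.
    rewrite (_ : c l' * S = 2^-1 ^+ l' * (2 * S)); last by rewrite /c mulrA [2 * _]mulrC.
    rewrite ler_wpM2r ?mulr_ge0//.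
    by apply: ler_wiXn2l; rewrite ?invf_le1 ?ler1n// leq_maxr.
  have cR : complex.Re (p k t) @[k --> \oo] --> fR t.
    have H : cvgn (fun k => complex.Re (p k t)).
      by apply: (cauchy (@complex.Re R)) => z w; rewrite -raddfB cabs_Re.
    have HE : (complex.Re (p k t))%:E @[k --> \oo] -->
        (limn (fun k => complex.Re (p k t)))%:E.
      by apply: cvg_EFin; [exact: nearW|exact: H].
    by rewrite /fR (cvg_limn_einf_sup HE).2.
  have cI : complex.Im (p k t) @[k --> \oo] --> fI t.
    have H : cvgn (fun k => complex.Im (p k t)).
      by apply: (cauchy (@complex.Im R)) => z w; rewrite -raddfB cabs_Im.
    have HE : (complex.Im (p k t))%:E @[k --> \oo] -->
        (limn (fun k => complex.Im (p k t)))%:E.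
      by apply: cvg_EFin; [exact: nearW|exact: H].
    by rewrite /fI (cvg_limn_einf_sup HE).2.
  have cf : cabs (p k t - p l t) ^+ 2 @[k --> \oo] --> cabs (f t - p l t) ^+ 2.
    under eq_cvg do rewrite cabs_sqr !raddfB/= !expr2.
    rewrite cabs_sqr !raddfB/= !expr2.
    by apply: cvgD; apply: cvgM; apply: cvgB => //; exact: cvg_cst.
  rewrite -(cvg_lim _ cf)//; apply: limr_le; first exact: cvgP cf.
  by exists l => // m /= lm; exact: dist.
have mfp l : measurable_fun [set: borel G] (fun t => (cabs (f t - p l t) ^+ 2)%:E).
  have [pR pI _] := besi_L2loc (p l).
  apply/measurable_EFinP; under eq_fun do rewrite cabs_sqr !raddfB/=.
  by apply: measurable_funD; apply: (measurable_funX 2); apply: measurable_funB.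
have int_bound l : (\int[mu]_(t in [set: borel G]) (cabs (f t - p l t) ^+ 2)%:E <=
    (mG * c l ^+ 2)%:E)%E.
  have mtail j : measurable_fun [set: borel G] (tail l j).
    exact: measurable_funeM.
  have msum : measurable_fun [set: borel G] (fun t => \sum_(j <oo) tail l j t)%E.
    by apply: ge0_emeasurable_sum => // j.
  apply: (@le_trans _ _ (\int[mu]_(t in [set: borel G])
     ((c l)%:E * \sum_(j <oo) tail l j t))%E).
    apply: ge0_le_integral => //.
    - by move=> t _; rewrite lee_fin sqr_ge0.
    - exact: measurable_funeM.
  rewrite ge0_integralZl_EFin//; last by move=> t _; apply: nneseries_ge0.
  apply: le_trans (lee_wpmul2l _ (tail_integral l)) _; first by rewrite lee_fin.
  by rewrite -EFinM lee_fin mulrCA -expr2.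
have lf : L2loc mu f.
  (* Square integrability of [f - p 0] is [int_bound] at 0. *)
  have -> : f = 1 *: (f - p 0%N) + p 0%N by rewrite scale1r subrK.
  apply: L2loc_lincomb; last exact: besi_L2loc.
  have [pR pI _] := besi_L2loc (p 0%N); split.
  - rewrite (_ : (fun t => _) = (fun t => fR t - complex.Re (p 0%N t))).
      exact: measurable_funB mfR pR.
    by apply/funext => t; rewrite raddfB.
  - rewrite (_ : (fun t => _) = (fun t => fI t - complex.Im (p 0%N t))).
      exact: measurable_funB mfI pI.
    by apply/funext => t; rewrite raddfB.
  - move=> K cK; apply: le_lt_trans (le_lt_trans (int_bound 0%N) (ltry _)).
    apply: ge0_subset_integral => //; first exact: borel_compact.
      exact: (mfp 0%N).
    by move=> t _; rewrite lee_fin sqr_ge0.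
exists f; split => // l; apply: mean_sqr_besi_norm.
have mG0 : 0 < mG.
  rewrite lt_neqAle mG_ge0 andbT eq_sym; apply/eqP => mG0.
  by have := haar_neq0 mu; rewrite mGE mG0 eqxx.
(* Once [A n] has more than half the total volume, averaging [mG * c l ^+ 2] over it gives at most
   [8 * (2^-1 ^+ l) ^+ 2]. *)
have : ((mG / 2)%:E < mu [set: borel G])%E by rewrite mGE lte_fin; lra.
move=> /(vh_volume_gt A); apply: filterS => n Hn.
rewrite /mean_sqr muleC lee_pdivrMr ?vh_fine_gt0//.
apply: (@le_trans _ _ (mG * c l ^+ 2)%:E).
  apply: le_trans (int_bound l); apply: ge0_subset_integral => //.
    exact: vh_measurable.
    exact: (mfp l).
  by move=> t _; rewrite lee_fin sqr_ge0.
rewrite -EFinM lee_fin /c exprMn.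
have : 0 <= (2^-1 ^+ l) ^+ 2 :> R by rewrite sqr_ge0.
move: Hn; set q := (2^-1 ^+ l) ^+ 2; set m := fine _; nra.
Qed.

End finite_volume.

Lemma completion : exists f : besi A,
  forall l, (besi_norm A (f - p l)%R <= (3 * 2^-1 ^+ l)%:E)%E.
Proof.
have [f [lf fp]] : exists f : G -> R[i], L2loc mu f /\
    forall l, (besi_norm A (f - p l)%R <= (3 * 2^-1 ^+ l)%:E)%E.
  have [mu_oo|mu_fin] := eqVneq (mu [set: borel G]) +oo%E.
    exact: completion_infinite.
  by apply: completion_finite; rewrite ltey.
by exists (Besi (asboolT (besi_of_approx lf fp))).
Qed.

End completion.

(** * Density of characters and completeness of the quotient *)

Section besi_hilbert.
Context (R : realType) (G : lcaGroupType) (mu : haar_measure R G).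
Context (A : van_hove_sequence mu).
Local Notation ip := (@besi_ip R G mu A).
Local Notation nrm := (ip_norm ip).

(** Supplies the boundedness that [completion] asks of the approximants. *)
Lemma besi_trig_bounded (s : seq (R[i] * dual R G)) :
  exists C : R, forall t, cabs (besi_trig A s t) <= C.
Proof.
exists (\sum_(c <- s) cabs c.1) => t; rewrite besi_trigE fct_sumE.
elim: s => [|c s IH].
  by rewrite !big_nil /cabs normr0.
rewrite !big_cons; apply: le_trans (cabsD _ _) _; rewrite lerD//.
by rewrite [_ t]/(c.1 * c.2 t) cabsM cabs_dual mulr1.
Qed.

Lemma besi_class_scale (a : R[i]) (f : besi A) :
  besi_class (a *: f) = a *: besi_class f.
Proof. exact: besi_classZ. Qed.

Lemma besi_classB (f f' : besi A) :
  besi_class (f - f') = besi_class f - besi_class f'.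
Proof. by rewrite -scaleN1r besi_classD besi_class_scale scaleN1r. Qed.

Lemma besi_class_trig (s : seq (R[i] * dual R G)) :
  besi_class (besi_trig A s) = \sum_(c <- s) c.1 *: besi_class (besi_char A c.2).
Proof.
rewrite /besi_trig; elim: s => [|c s IH]; first by rewrite !big_nil besi_class0.
by rewrite !big_cons besi_classD besi_class_scale IH.
Qed.

Lemma besi_quot_approx (x : besi_quot A) (e : R) : 0 < e ->
  exists s, nrm (x - besi_class (besi_trig A s)) < e.
Proof.
move=> e0; have [s sP] := besi_approx (repr x) e0; exists s.
rewrite -{1}(besi_class_repr x) -besi_classB.
by rewrite -lte_fin ip_norm_besi_class -besi_normE.
Qed.

Lemma besi_char_dense (x : besi_quot A) (e : R) : 0 < e ->
  exists s : seq (R[i] * dual R G),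
    nrm (x - \sum_(c <- s) c.1 *: besi_class (besi_char A c.2)) < e.
Proof. by move=> /(besi_quot_approx x)[s sP]; exists s; rewrite -besi_class_trig. Qed.

Lemma besi_ip_char (chi psi : dual R G) :
  ip (besi_class (besi_char A chi)) (besi_class (besi_char A psi)) = (chi == psi)%:R.
Proof. by rewrite besi_ip_class; apply: limit_ip_eq; exact: mean_ip_char_cvg. Qed.

(** Trigonometric polynomials [p k] near [u (N k)] form a sequence with increments below
    [2^-1 ^+ k]; the function that [completion] provides for them is also the limit of [u]. *)
Lemma besi_quot_complete (u : nat -> besi_quot A) :
  (forall e : R, 0 < e -> exists N, forall m n, (N <= m)%N -> (N <= n)%N ->
     nrm (u m - u n) < e) ->
  exists l : besi_quot A, nrm (u n - l) @[n --> \oo] --> (0 : R).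
Proof.
(* The tolerances add up to 9/16 of [r] here, and to less than [4 * r] in [arith2]. *)
have arith1 (X Y Z a b c d r : R) : X <= a + Y -> Y <= b + Z -> Z <= c + d ->
    a < r / 2 / 8 -> d < r / 8 -> c < r / 4 -> b < r / 2 / 4 -> 0 < r -> X < r.
  by move=> *; lra.
have arith2 (X Y a b c r e : R) : X <= a + Y -> Y <= b + c ->
    a < r / 4 -> b < r / 8 -> c <= 3 * r -> 0 < r -> 4 * r < e -> X < e.
  by move=> *; lra.
have P := besi_ip_semi_inner A.
move=> uC; pose h k : R := 2^-1 ^+ k.
have h0 k : 0 < h k by rewrite exprn_gt0.
have hS k : h k.+1 = h k / 2 by rewrite /h exprSr.
have [N NP] := choice (fun k => uC (h k / 4) (divr_gt0 (h0 k) (ltr0n _ 4))).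
have [s sP] := choice (fun k => besi_quot_approx (u (N k)) (divr_gt0 (h0 k) (ltr0n _ 8))).
pose p k := besi_trig A (s k).
have normB (f f' : besi A) :
    besi_norm A (f - f')%R = (nrm (besi_class f - besi_class f'))%:E.
  by rewrite [LHS](besi_normE (f - f')) -ip_norm_besi_class besi_classB.
have [k|k|f fP] := @completion R G mu A p.
- exact: besi_trig_bounded.
- rewrite normB lte_fin.
  have := sP k; have := sP k.+1; have hk := h0 k; rewrite hS => b1 b2.
  (* [N] need not be monotone, so [u (N k)] and [u (N k.+1)] are compared through the term at the
     larger of the two indices. *)
  have m := NP k _ _ (leq_maxr (N k.+1) (N k)) (leqnn _).
  have m' := NP k.+1 _ _ (leq_maxl (N k.+1) (N k)) (leqnn _); rewrite hS in m'.
  move: m m'; set v := u (maxn _ _) => m m'.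
  rewrite -/(p k) -/(p k.+1) in b1 b2 *.
  set q := besi_class (p k) in b2 *; set q' := besi_class (p k.+1) in b1 *.
  have -> : q' - q = - (u (N k.+1) - q') + (- (v - u (N k.+1)) +
      ((v - u (N k)) + (u (N k) - q))).
    by rewrite subrKA !opprB addrA subrKA subrKA.
  have d1 := snormD P (- (u (N k.+1) - q'))
    (- (v - u (N k.+1)) + ((v - u (N k)) + (u (N k) - q))).
  have d2 := snormD P (- (v - u (N k.+1))) ((v - u (N k)) + (u (N k) - q)).
  have d3 := snormD P (v - u (N k)) (u (N k) - q).
  rewrite !(snormN P) in d1 d2.
  exact: arith1 d1 d2 d3 b1 b2 m m' hk.
exists (besi_class f); apply/cvgrPdist_lt => e e0.
have [l le] : exists l, 4 * h l < e.
  have /cvgrPdist_lt /(_ _ (divr_gt0 e0 (ltr0n _ 4))) [l _ /(_ l (leqnn l))] :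
      (GRing.exp (2^-1 : R)) @ \oo --> (0 : R).
    by apply: cvg_expr; rewrite ger0_norm// invf_lt1// ltr1n.
  by rewrite /= sub0r normrN ger0_norm ?exprn_ge0// ltr_pdivlMr// mulrC; exists l.
exists (N l) => // n /= Nn; rewrite sub0r normrN ger0_norm ?snorm_ge0//.
have := fP l; rewrite normB lee_fin -/(h l) (snormB P) => b3.
have b1 := NP l n (N l) Nn (leqnn _); have b2 := sP l; rewrite -/(p l) in b2.
have d1 := snormD P (u n - u (N l)) ((u (N l) - besi_class (p l)) +
  (besi_class (p l) - besi_class f)).
have d2 := snormD P (u (N l) - besi_class (p l)) (besi_class (p l) - besi_class f).
rewrite !subrKA in d1 d2.
exact: arith2 d1 d2 b1 b2 b3 (h0 l) le.
Qed.

End besi_hilbert.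

(** * Fourier-Bohr coefficients and assembly of the theorem *)

Lemma fourier_bohr_cvg (R : realType) (G : lcaGroupType) (mu : haar_measure R G)
    (A : van_hove_sequence mu) (f : besi A) (chi : dual R G) :
  cvgC (mean A (fun t => (chi t)^* * f t)) (limit_ip f (besi_char A chi)).
Proof.
have -> : (fun t => (chi t)^* * f t) = (fun t => f t * (chi t)^* ).
  by apply/funext => t; rewrite mulrC.
exact: limit_ip_cvg.
Qed.

Lemma fourier_bohrE (R : realType) (G : lcaGroupType) (mu : haar_measure R G)
    (A : van_hove_sequence mu) (f : besi A) (chi : dual R G) :
  fourier_bohr A f chi = besi_ip (besi_class f) (besi_class (besi_char A chi)).
Proof.
rewrite besi_ip_class; congr (lim (mean A _ @ \oo)).
by apply/funext => t; rewrite mulrC.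
Qed.

Theorem theorem4p16 (R : realType) (G : lcaGroupType) (mu : haar_measure R G)
    (A : van_hove_sequence mu) :
  (* (a) *)
  [/\ (forall f g : besi A,
         mean A (fun t => f t * (g t)^* ) @ \oo
           --> (besi_ip (besi_class f) (besi_class g) : R[i]^o)),
      inner_product (@besi_ip R G mu A),
      (forall f : besi A, besi_quot_norm (besi_class f) = besi_norm A f) &
      (forall x : besi_quot A,
         besi_quot_norm x = (ip_norm (@besi_ip R G mu A) x)%:E)] /\
  (* (b) *)
  hilbert_space (@besi_ip R G mu A) /\
  (* (c) *)
  orthogonal_basis (@besi_ip R G mu A)
    (fun chi : dual R G => besi_class (besi_char A chi)) /\
  (* (d) *)
  (forall (f : besi A) (chi : dual R G),
     mean A (fun t => (chi t)^* * f t) @ \oo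
       --> (fourier_bohr A f chi : R[i]^o) /\
     fourier_bohr A f chi
       = besi_ip (besi_class f) (besi_class (besi_char A chi))) /\
  (* (e) *)
  (forall f : besi A,
     [/\ countable [set chi : dual R G | fourier_bohr A f chi != 0],
         (besi_norm A f ^+ 2
           = \esum_(chi in [set: dual R G])
               (cabs (fourier_bohr A f chi) ^+ 2)%:E)%E &
         (fun F : {fset dual R G} => besi_quot_norm
           (besi_class f - \sum_(chi <- F)
              fourier_bohr A f chi *: besi_class (besi_char A chi)))
           @ totally --> 0%E]).

Proof.
have P := besi_ip_semi_inner A.
split; [split|split; [|split; [|split]]].
- by move=> f g; rewrite besi_ip_class; exact: limit_ip_cvg.
- exact: besi_ip_inner_product.
- exact: besi_quot_norm_class.
- exact: besi_quot_normE.
- split; [exact: besi_ip_inner_product|exact: besi_quot_complete].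
- split.
  + move=> chi; apply/eqP => chi0; have := besi_ip_char A chi chi.
    by rewrite chi0 (semi_inner0l P) eqxx => /eqP; rewrite eq_sym oner_eq0.
  + by move=> chi psi /negbTE chipsi; rewrite besi_ip_char chipsi.
  + exact: besi_char_dense.
- move=> f chi; split; last exact: fourier_bohrE.
  by rewrite fourier_bohrE besi_ip_class; exact: fourier_bohr_cvg.
move=> f; have fE := fourier_bohrE f; have bP := besi_ip_char A.
have dense := @besi_char_dense R G mu A.
split.
- rewrite (_ : [set _ | _] = [set chi |
      besi_ip (besi_class f) (besi_class (besi_char A chi)) != 0]).
    exact: (countable_fourier P bP dense).
  by apply/seteqP; split=> chi /=; rewrite fE.
- rewrite -besi_quot_norm_class besi_quot_normE -EFin_expe.
  rewrite (parseval P bP dense); apply: eq_esum => chi _.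
  by rewrite fE.
- have FF : ProperFilter (@totally (dual R G)) by exact: totally_filter.
  apply: cvg_EFin.
    by apply: nearW => F; rewrite besi_quot_normE.
  apply/cvgrPdist_lt => e e0.
  have [F0 F0P] := fourier_tail P bP dense (besi_class f) e0.
  exists F0 => // F /= F0F; rewrite besi_quot_normE /= sub0r normrN.
  rewrite ger0_norm ?snorm_ge0//.
  by under eq_bigr do rewrite fE; exact: F0P.
Qed.
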